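(* Let $X$ be a real Banach space which is an $L_1$-predual or an $M$-embedded space, and let $Y$ be a finite co-dimensional closed subspace of $X$. If $Y$ has property-$(HB)$ in $X$, then $Y^{\perp\perp}$ has property-$(HB)$ in $X^{**}$.
   Context: $X$ is an $L_1$-predual if $X^*$ is isometrically isomorphic to $L_1(\mu)$ for some measure $\mu$; $X$ is $M$-embedded if its canonical image is an $M$-ideal in $X^{**}$ (a closed subspace $J$ of $E$ is an $M$-ideal if $E^*=J^\perp\oplus W$ for a closed subspace $W$ with $\|u+w\|=\|u\|+\|w\|$ for $u\in J^\perp,w\in W$). $Y^\perp=\{x^*\in X^*:x^*|_Y=0\}$ and $Y^{\perp\perp}\subseteq X^{**}$ its annihilator. A closed subspace $V$ of $E$ has property-$(HB)$ in $E$ if there is a linear projection $P$ on $E^*$ with range $V^\perp$ and $\|P\|=1$ such that, writing $G=(I-P)(E^* )$, for every $e^*=v^\#+v^\perp$ with $v^\#\in G$, $0\neq v^\perp\in V^\perp$, one has $\|e^*\|>\|v^\#\|$ and $\|e^*\|\ge\|v^\perp\|$. *)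

(* Defs.v *)
From HB Require Import structures.
From mathcomp Require Import all_boot all_order all_algebra.
From mathcomp Require Import all_classical all_reals all_analysis.
Unset Printing Implicit Defensive.
Import Order.TTheory GRing.Theory Num.Theory.
Import numFieldNormedType.Exports.
Local Open Scope classical_set_scope.
Local Open Scope ring_scope.

(* A (real) normed space presented concretely: a carrier lmodType [ns_car],
   the set [ns_dom] of its elements that belong to the space (a linear
   subspace of the carrier), and the norm [ns_norm] on it.  This lets us
   iterate duals of X as genuine function spaces. *)
Inductive nspace (R : realType) : Type :=
  NSpace (car : lmodType R) of set car & (car -> R).
Definition ns_car {R} (E : nspace R) : lmodType R :=
  let: NSpace c _ _ := E in c.
Definition ns_dom {R} (E : nspace R) : set (ns_car E) :=
  let: NSpace _ d _ := E in d.
Definition ns_norm {R} (E : nspace R) : ns_car E -> R :=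
  let: NSpace _ _ n := E in n.

Section Duals.
Context {R : realType}.

Definition nspace_of (X : normedModType R) : nspace R :=
  @NSpace R X setT (fun x : X => `|x|).

(* Continuous linear functionals on E: linear on the space, bounded, and
   (for uniqueness of representatives) vanishing outside of it. *)
Definition dual_dom (E : nspace R) : set (ns_car E -> R) :=
  [set f | (forall x, ~ ns_dom E x -> f x = 0) /\
           (forall (a : R) x y, ns_dom E x -> ns_dom E y ->
               f (a *: x + y) = a * f x + f y) /\
           (exists M : R, forall x, ns_dom E x -> `|f x| <= M * ns_norm E x)].

Definition dual_norm (E : nspace R) (f : ns_car E -> R) : R :=
  sup [set `|f x| | x in [set x | ns_dom E x /\ ns_norm E x <= 1]].

Definition dual (E : nspace R) : nspace R :=
  @NSpace R (ns_car E -> R : lmodType R) (dual_dom E) (dual_norm E).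

Definition is_subspace (E : nspace R) (V : set (ns_car E)) : Prop :=
  V `<=` ns_dom E /\ V 0 /\
  (forall (a : R) x y, V x -> V y -> V (a *: x + y)).

Definition ns_closed (E : nspace R) (V : set (ns_car E)) : Prop :=
  forall (s : nat -> ns_car E) (x : ns_car E),
    (forall n, V (s n)) -> ns_dom E x ->
    (fun n => ns_norm E (s n - x)) @ \oo --> (0 : R) -> V x.

Definition annihilator (E : nspace R) (V : set (ns_car E)) :
  set (ns_car (dual E)) :=
  [set f | dual_dom E f /\ forall x, V x -> f x = 0].

Definition M_ideal (E : nspace R) (J : set (ns_car E)) : Prop :=
  is_subspace E J /\ ns_closed E J /\
  exists W : set (ns_car (dual E)),
    is_subspace (dual E) W /\ ns_closed (dual E) W /\
    (forall f, annihilator E J f -> W f -> f = 0) /\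
    (forall f, dual_dom E f ->
       exists u w, annihilator E J u /\ W w /\ f = u + w) /\
    (forall u w, annihilator E J u -> W w ->
       dual_norm E (u + w) = dual_norm E u + dual_norm E w).

Definition canon (X : normedModType R) (x : X) :
  ns_car (dual (dual (nspace_of X))) :=
  fun f => if `[< dual_dom (nspace_of X) f >] then f x else 0.

Definition M_embedded (X : normedModType R) : Prop :=
  M_ideal (dual (dual (nspace_of X))) (range (@canon X)).

(* L_1-predual: X^* is isometrically isomorphic to L_1(mu) (real-valued
   integrable functions modulo mu-a.e. equality) for some measure mu. *)
Definition L1_predual (X : normedModType R) : Prop :=
  exists (d : measure_display) (T : measurableType d)
         (mu : {measure set T -> \bar R})
         (Phi : (X -> R) -> T -> R),
    (forall f, dual_dom (nspace_of X) f ->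
        mu.-integrable setT (fun t => (Phi f t)%:E)) /\
    (forall (a : R) f g, dual_dom (nspace_of X) f ->
        dual_dom (nspace_of X) g ->
        {ae mu, forall t, Phi (a *: f + g) t = a * Phi f t + Phi g t}) /\
    (forall f, dual_dom (nspace_of X) f ->
        ((dual_norm (nspace_of X) f)%:E =
          \int[mu]_t (`|Phi f t|)%:E)%E) /\
    (forall h : T -> R, mu.-integrable setT (fun t => (h t)%:E) ->
        exists f, dual_dom (nspace_of X) f /\
          {ae mu, forall t, Phi f t = h t}).

Definition property_HB (E : nspace R) (V : set (ns_car E)) : Prop :=
  exists P : ns_car (dual E) -> ns_car (dual E),
    (forall (a : R) f g, dual_dom E f -> dual_dom E g ->
        P (a *: f + g) = a *: P f + P g) /\
    (forall f, dual_dom E f -> P (P f) = P f) /\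
    P @` (dual_dom E) = annihilator E V /\
    sup [set dual_norm E (P f) | f in
          [set f | dual_dom E f /\ dual_norm E f <= 1]] = 1 /\
    (forall g v, ((fun f => f - P f) @` dual_dom E) g ->
        annihilator E V v -> v <> 0 ->
        dual_norm E g < dual_norm E (g + v) /\
        dual_norm E v <= dual_norm E (g + v)).

Definition finite_codim_closed_subspace (X : normedModType R) (Y : set X)
  : Prop :=
  closed Y /\ Y 0 /\ (forall (a : R) x y, Y x -> Y y -> Y (a *: x + y)) /\
  exists (n : nat) (e : 'I_n -> X), forall x : X,
    exists y (c : 'I_n -> R), Y y /\ x = y + \sum_(i < n) c i *: e i.

End Duals.

(* Main.v *)
(* The point is that X^* is an L-summand of its bidual: there is a linear
   complement S of X^* in X^*** with |f + s| = |f| + |s|.  If pi is the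
   projection onto X^* along S and P is the projection given by (HB) for Y, then
   P o pi works for the bidual, because annihilating Y^perp^perp gives back the
   finite-dimensional space Y^perp.

   If X is M-embedded, S is the annihilator of X.  If X^* = L_1(mu), S is the
   band of functionals disjoint from L_1(mu).  A positive F on L_1(mu)^* has a
   maximal minorant x in L_1(mu), and G = F - x is disjoint from every e >= 0:
   if H = inf(G, e) were nonzero, a Hahn decomposition of
   A |-> H(I 1_A) - t I(e 1_A) would give a nonzero minorant t e 1_A of G.  No
   representation of L_1(mu)^* by functions is used (mu is arbitrary): the Riesz
   decomposition property and Hahn decompositions suffice. *)
Require Import Defs.
From HB Require Import structures.
From mathcomp Require Import all_boot all_order all_algebra.
From mathcomp Require Import all_classical all_reals all_analysis.
From mathcomp Require Import measurable_realfun ring lra.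
Unset Printing Implicit Defensive.
Import Order.TTheory GRing.Theory Num.Theory.
Import numFieldNormedType.Exports.
Local Open Scope classical_set_scope.
Local Open Scope ring_scope.

(** * Normed spaces and their duals *)

(** For F = j f + s, with j the embedding of X^* into X^***, the part of F complementary to the new
    projection is j (f - P f) + s, and adding j v leaves s alone. Norm additivity makes |s| appear
    on both sides of the strict inequality of (HB), where it cancels; a merely contractive
    projection onto X^* would not allow this.

    When X^* = L_1(mu), the product of a functional psi with an indicator exists as psi composed
    with M_A, but functionals cannot be multiplied with each other, nor are they limits of simple
    functions. Both passages from indicators to general elements, one in L_1 and one in its dual,
    therefore go by dyadic halving: a fixed error bound is halved at each step. The order axioms
    hold for X^* and pass to duals, so they are at hand in X^** and X^*** as well. Singularity of s
    is expressed by some 0 <= chi <= I for which s chi and (I - chi) e are both small, because such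
    a chi is what glues a functional norming f to one norming s. *)

Definition is_nspace {R : realType} (E : nspace R) : Prop :=
  [/\ is_subspace E (ns_dom E),
      forall a x, ns_dom E x -> ns_norm E (a *: x) = `|a| * ns_norm E x &
      forall x y, ns_dom E x -> ns_dom E y ->
        ns_norm E (x + y) <= ns_norm E x + ns_norm E y].

Section NormedSpaces.
Context {R : realType} (E : nspace R).
Hypothesis nsE : is_nspace E.
Implicit Types (x y : ns_car E) (f g : ns_car E -> R) (a : R).

Lemma ns_dom0 : ns_dom E 0. Proof. by case: nsE => -[_ []]. Qed.

Lemma ns_domP a x y : ns_dom E x -> ns_dom E y -> ns_dom E (a *: x + y).
Proof. by case: nsE => -[_ [_ h]] _ _; exact: h. Qed.

Lemma ns_domZ a x : ns_dom E x -> ns_dom E (a *: x).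
Proof. by move=> hx; rewrite -[_ *: _]addr0; exact: ns_domP ns_dom0. Qed.

Lemma ns_domD x y : ns_dom E x -> ns_dom E y -> ns_dom E (x + y).
Proof. by move=> hx; rewrite -[x]scale1r; exact: ns_domP. Qed.

Lemma ns_domN x : ns_dom E x -> ns_dom E (- x).
Proof. by move=> hx; rewrite -scaleN1r; exact: ns_domZ. Qed.

Lemma ns_domB x y : ns_dom E x -> ns_dom E y -> ns_dom E (x - y).
Proof. by move=> hx hy; apply: ns_domD => //; exact: ns_domN. Qed.

Lemma ns_normZ a x : ns_dom E x -> ns_norm E (a *: x) = `|a| * ns_norm E x.
Proof. by case: nsE => _ h _; exact: h. Qed.

Lemma ns_normD x y : ns_dom E x -> ns_dom E y ->
  ns_norm E (x + y) <= ns_norm E x + ns_norm E y.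
Proof. by case: nsE => _ _ h; exact: h. Qed.

Lemma ns_norm0 : ns_norm E 0 = 0.
Proof. by rewrite -(scale0r 0) ns_normZ ?normr0 ?mul0r//; exact: ns_dom0. Qed.

Lemma ns_normN x : ns_dom E x -> ns_norm E (- x) = ns_norm E x.
Proof. by move=> hx; rewrite -scaleN1r ns_normZ// normrN1 mul1r. Qed.

Lemma ns_normB x y : ns_dom E x -> ns_dom E y ->
  ns_norm E (x - y) <= ns_norm E x + ns_norm E y.
Proof.
move=> hx hy; apply: le_trans (ns_normD _ _ hx (ns_domN _ hy)) _.
by rewrite ns_normN.
Qed.

Lemma ns_norm_ge0 x : ns_dom E x -> 0 <= ns_norm E x.
Proof.
move=> hx; have := ns_normB _ _ hx hx.
by rewrite subrr ns_norm0 -mulr2n pmulrn_lge0.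
Qed.

Section Functional.
Variable f : ns_car E -> R.
Hypothesis df : dual_dom E f.

Lemma dual_out x : ~ ns_dom E x -> f x = 0.
Proof. by case: df => h _; exact: h. Qed.

Lemma dual_lin a x y : ns_dom E x -> ns_dom E y ->
  f (a *: x + y) = a * f x + f y.
Proof. by case: df => _ [h _]; exact: h. Qed.

Lemma dual0 : f 0 = 0.
Proof.
have := dual_lin 1 0 0 ns_dom0 ns_dom0.
by rewrite scaler0 addr0 mul1r; lra.
Qed.

Lemma dualZ a x : ns_dom E x -> f (a *: x) = a * f x.
Proof.
by move=> hx; rewrite -[_ *: _]addr0 dual_lin ?dual0 ?addr0//; exact: ns_dom0.
Qed.

Lemma dualD x y : ns_dom E x -> ns_dom E y -> f (x + y) = f x + f y.
Proof. by move=> hx hy; rewrite -{1}[x]scale1r dual_lin// mul1r. Qed.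

Lemma dualN x : ns_dom E x -> f (- x) = - f x.
Proof. by move=> hx; rewrite -scaleN1r dualZ// mulN1r. Qed.

Lemma dualB x y : ns_dom E x -> ns_dom E y -> f (x - y) = f x - f y.
Proof. by move=> hx hy; rewrite dualD ?dualN//; exact: ns_domN. Qed.

Lemma dual_bound : exists2 M, 0 <= M &
  forall x, ns_dom E x -> `|f x| <= M * ns_norm E x.
Proof.
(* The constant in [dual_dom] can be negative if the norm vanishes identically. *)
case: df => _ [_ [M hM]]; exists (Num.max M 0); first by rewrite le_max lexx orbT.
move=> x hx; apply: le_trans (hM x hx) _; apply: ler_wpM2r.
  exact: ns_norm_ge0.
by rewrite le_max lexx.
Qed.

Lemma dual_norm_has_ub :
  has_ubound [set `|f x| | x in [set x | ns_dom E x /\ ns_norm E x <= 1]].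
Proof.
have [M M0 hM] := dual_bound.
exists M => _ [x [hx x1] <-]; apply: le_trans (hM x hx) _.
by rewrite -[leRHS]mulr1 ler_wpM2l.
Qed.

Lemma dual_norm_ge0 : 0 <= dual_norm E f.
Proof.
apply: le_trans (normr_ge0 (f 0)) _; rewrite /dual_norm; apply: (ub_le_sup dual_norm_has_ub).
by exists 0 => //; split; [exact: ns_dom0|rewrite ns_norm0].
Qed.

Lemma dual_norm_ub x : ns_dom E x -> `|f x| <= dual_norm E f * ns_norm E x.
Proof.
(* [is_nspace] allows nonzero vectors of norm 0; on them the boundedness constant forces [f x = 0].
   Other vectors are rescaled into the unit ball. *)
move=> hx; have := ns_norm_ge0 x hx; rewrite le_eqVlt => /predU1P[x0|x0].
  have [M M0 hM] := dual_bound.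
  by rewrite -x0 mulr0; have := hM x hx; rewrite -x0 mulr0.
have iN : 0 <= (ns_norm E x)^-1 by rewrite invr_ge0 ltW.
rewrite -ler_pdivrMr// mulrC -[X in X * _]ger0_norm//.
rewrite -normrM -dualZ//; apply: (ub_le_sup dual_norm_has_ub).
exists ((ns_norm E x)^-1 *: x) => //; split; first exact: ns_domZ.
by rewrite ns_normZ// ger0_norm// mulVf// gt_eqF.
Qed.

Lemma dual_norm_ub1 x : ns_dom E x -> ns_norm E x <= 1 -> `|f x| <= dual_norm E f.
Proof.
move=> hx x1; apply: le_trans (dual_norm_ub x hx) _.
by rewrite -[leRHS]mulr1 ler_wpM2l ?dual_norm_ge0.
Qed.

Lemma dual_norm_adherent eps : 0 < eps ->
  exists x, [/\ ns_dom E x, ns_norm E x <= 1 & dual_norm E f - eps < f x].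
Proof.
move=> e0.
have hs : has_sup [set `|f x| | x in [set x | ns_dom E x /\ ns_norm E x <= 1]].
  split; last exact: dual_norm_has_ub.
  by exists `|f 0|, 0 => //; split; [exact: ns_dom0|rewrite ns_norm0].
have [_ [x [hx x1] <-] hlt] := sup_adherent e0 hs.
have [fx0|fx0] := leP 0 (f x).
  by exists x; split => //; rewrite -(ger0_norm fx0).
exists (- x); split; [exact: ns_domN|by rewrite ns_normN|].
by rewrite dualN// -(ltr0_norm fx0).
Qed.

End Functional.

Lemma dual_norm_le f c :
  (forall x, ns_dom E x -> ns_norm E x <= 1 -> `|f x| <= c) ->
  dual_norm E f <= c.
Proof.
move=> h; apply: ge_sup; last by move=> _ [x [? ?] <-]; exact: h.
by exists `|f 0|, 0 => //; split; [exact: ns_dom0|rewrite ns_norm0].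
Qed.

Lemma dual_norm_eq0 f : dual_dom E f -> dual_norm E f <= 0 -> f = 0.
Proof.
move=> df f0; apply/funext => x; have [hx|hx] := pselect (ns_dom E x); last first.
  by rewrite (dual_out _ df).
apply/eqP; rewrite -normr_le0; apply: le_trans (dual_norm_ub _ df _ hx) _.
by apply: mulr_le0_ge0 => //; exact: ns_norm_ge0.
Qed.

Lemma dual_domI f M :
  (forall x, ~ ns_dom E x -> f x = 0) ->
  (forall a x y, ns_dom E x -> ns_dom E y -> f (a *: x + y) = a * f x + f y) ->
  (forall x, ns_dom E x -> `|f x| <= M * ns_norm E x) -> dual_dom E f.
Proof. by move=> h1 h2 h3; split => //; split => //; exists M. Qed.

Lemma dual_dom_lin a f g : dual_dom E f -> dual_dom E g ->
  dual_dom E ((a *: (f : ns_car (dual E)) + g) : ns_car (dual E)).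
Proof.
move=> df dg; have [M M0 hM] := dual_bound _ df.
have [K K0 hK] := dual_bound _ dg.
have ev x : (a *: (f : ns_car (dual E)) + g : ns_car (dual E)) x = a * f x + g x.
  by [].
apply: (dual_domI _ (`|a| * M + K)) => [x hx|b x y hx hy|x hx]; rewrite ev.
- by rewrite !dual_out// mulr0 addr0.
- by rewrite !ev !dual_lin//; ring.
- apply: le_trans (ler_normD _ _) _; rewrite mulrDl lerD ?hK//.
  by rewrite normrM -mulrA ler_wpM2l ?hM.
Qed.

Lemma dual_dom0 : dual_dom E 0.
Proof.
apply: (dual_domI _ 0) => // [a x y _ _|x _]; rewrite /= ?mulr0 ?addr0 //.
by rewrite normr0 mul0r.
Qed.

Lemma dual_is_nspace : is_nspace (dual E).
Proof.
split => /=.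
- split => //; split; first exact: dual_dom0.
  by move=> a f g; exact: dual_dom_lin.
- move=> a f df; have [->|a0] := eqVneq a 0.
    rewrite scale0r normr0 mul0r; apply/eqP; rewrite eq_le; apply/andP; split.
      by apply: dual_norm_le => x _ _; rewrite normr0.
    by rewrite dual_norm_ge0//; exact: dual_dom0.
  have key (b : R) g : dual_dom E g ->
      dual_norm E (b *: (g : ns_car (dual E)) : ns_car (dual E)) <= `|b| * dual_norm E g.
    move=> dg; apply: dual_norm_le => x hx x1.
    rewrite (_ : _ x = b * g x)// normrM ler_wpM2l//; exact: dual_norm_ub1.
  have daf : dual_dom E (a *: (f : ns_car (dual E)) : ns_car (dual E)).
    by rewrite -[_ *: _]addr0; apply: dual_dom_lin => //; exact: dual_dom0.
  apply/eqP; rewrite eq_le key//=.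
  have := key a^-1 _ daf; rewrite scalerA mulVf// scale1r normfV.
  by rewrite ler_pdivlMl ?normr_gt0.
- move=> f g df dg; apply: dual_norm_le => x hx x1.
  rewrite (_ : _ x = f x + g x)//; apply: le_trans (ler_normD _ _) _.
  by rewrite lerD ?dual_norm_ub1.
Qed.

End NormedSpaces.

Lemma nspace_of_is_nspace {R : realType} (X : normedModType R) :
  is_nspace (nspace_of X).
Proof.
split => //=; [by move=> a x _; rewrite normrZ|by move=> x y _ _; exact: ler_normD].
Qed.

Section Bidual.
Context {R : realType} (E : nspace R).
Hypothesis nsE : is_nspace E.
Let nsE1 := dual_is_nspace _ nsE.

(** This is [canon] over an arbitrary space. For [nspace_of X] the two are convertible, which is how
    [M_embedded] is used at the end. *)
Definition bicanon (x : ns_car E) : ns_car (dual (dual E)) :=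
  fun f => if `[< dual_dom E f >] then f x else 0.

Lemma bicanonE x f : dual_dom E f -> bicanon x f = f x.
Proof. by move=> df; rewrite /bicanon asboolT. Qed.

Lemma bicanon_out x f : ~ dual_dom E f -> bicanon x f = 0.
Proof. by move=> df; rewrite /bicanon asboolF. Qed.

Lemma bicanon_dom x : ns_dom E x -> dual_dom (dual E) (bicanon x).
Proof.
move=> hx; apply: (dual_domI _ _ (ns_norm E x)) => /= [f|a f g df dg|f df].
- exact: bicanon_out.
- by rewrite !bicanonE//; exact: dual_dom_lin.
- by rewrite bicanonE// mulrC; exact: dual_norm_ub.
Qed.

Lemma bicanon_lin a x y : ns_dom E x -> ns_dom E y ->
  bicanon (a *: x + y) = a *: bicanon x + bicanon y.
Proof.
move=> hx hy; apply/funext => f; rewrite (_ : (_ + _) f = a * bicanon x f + bicanon y f)//.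
have [df|df] := pselect (dual_dom E f); last by rewrite !bicanon_out// mulr0 addr0.
by rewrite !bicanonE// dual_lin.
Qed.

Lemma bicanonD x y : ns_dom E x -> ns_dom E y ->
  bicanon (x + y) = bicanon x + bicanon y.
Proof. by move=> hx hy; rewrite -{1}[x]scale1r bicanon_lin// scale1r. Qed.

Lemma bicanonB x y : ns_dom E x -> ns_dom E y ->
  bicanon (x - y) = bicanon x - bicanon y.
Proof.
by move=> hx hy; rewrite addrC -scaleN1r bicanon_lin// scaleN1r addrC.
Qed.

Lemma bicanon_norm_le x : ns_dom E x ->
  dual_norm (dual E) (bicanon x) <= ns_norm E x.
Proof.
move=> hx; apply: dual_norm_le => // f df f1.
rewrite bicanonE//; apply: le_trans (dual_norm_ub _ nsE _ df _ hx) _.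
by rewrite -[leRHS]mul1r ler_wpM2r// ns_norm_ge0.
Qed.

End Bidual.

(** For a dual space no Hahn-Banach argument is required: the norm of [f] is already approached on
    the evaluations at points of [E], which lie in the unit ball of the bidual. *)
Lemma bicanon_isometry {R : realType} (E : nspace R) (f : ns_car (dual E)) :
  is_nspace E -> dual_dom E f ->
  dual_norm (dual (dual E)) (bicanon (dual E) f) = dual_norm E f.
Proof.
move=> nsE df; have nsE1 := dual_is_nspace _ nsE.
have nsE2 := dual_is_nspace _ nsE1.
apply/eqP; rewrite eq_le bicanon_norm_le//=.
apply: dual_norm_le => // x hx x1.
have dx := bicanon_dom _ nsE _ hx.
rewrite -(bicanonE _ x f df) -(bicanonE (dual E) f _ dx).
apply: dual_norm_ub1 => //; first exact: bicanon_dom.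
by apply: le_trans x1; exact: bicanon_norm_le.
Qed.

(** * From an L-decomposition of the third dual to property (HB) *)

Section Annihilators.
Context {R : realType} (E : nspace R).
Hypothesis nsE : is_nspace E.
Let nsE1 := dual_is_nspace _ nsE.
Let nsE2 := dual_is_nspace _ nsE1.

Lemma annihilator_subspace (V : set (ns_car E)) :
  is_subspace (dual E) (annihilator E V).
Proof.
split; first by move=> f [].
split; first by split; [exact: dual_dom0|].
move=> a f g [df f0] [dg g0]; split; first exact: dual_dom_lin.
move=> x Vx; rewrite (_ : _ x = a * f x + g x)// f0// g0//.
by rewrite mulr0 addr0.
Qed.

(* Induction on the number of separating points: if some [v0] in [V] takes the
   value 1 at the last point [e], subtracting a multiple of its image from [F]
   reduces to the subspace of those [v] in [V] which vanish at [e]. *)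
Lemma finite_dim_weak_star_closed n (e : 'I_n -> ns_car E)
    (V : set (ns_car (dual E))) (F : ns_car (dual (dual (dual E)))) :
  (forall i, ns_dom E (e i)) -> is_subspace (dual E) V ->
  (forall v, V v -> (forall i, v (e i) = 0) -> v = 0) ->
  annihilator (dual (dual E)) (annihilator (dual E) V) F ->
  exists2 v, V v & F = bicanon (dual E) v.
Proof.
elim: n e V F => [|n IH] e V F de subV sepV [dF F0].
  have [Vdom [V0 _]] := subV.
  exists 0 => //; apply/funext => phi.
  have [dphi|dphi] := pselect (dual_dom (dual E) phi); last first.
    by rewrite bicanon_out// (dual_out (dual (dual E)) _ dF).
  rewrite bicanonE// (dual0 _ nsE1)//; apply: F0; split => // v Vv.
  by rewrite (sepV v Vv) ?(dual0 _ nsE1)//; case.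
have [Vdom [V0 Vlin]] := subV.
pose e' (i : 'I_n) := e (widen_ord (leqnSn n) i).
pose x := e ord_max.
have dx : ns_dom E x by exact: de.
pose V' : set (ns_car (dual E)) := [set v | V v /\ v x = 0].
have subV' : is_subspace (dual E) V'.
  split; first by move=> v [/Vdom].
  split; first by split.
  move=> a u w [Vu u0] [Vw w0]; split; first exact: Vlin.
  by rewrite (_ : _ x = a * u x + w x)// u0 w0 mulr0 addr0.
have sepV' v : V' v -> (forall i, v (e' i) = 0) -> v = 0.
  move=> [Vv v0] ve; apply: sepV => // i.
  have [in_|ni] := ltnP i n.
    by rewrite -(ve (Ordinal in_)) /e'; congr (v (e _)); apply/val_inj.
  rewrite -v0 /x; congr (v (e _)); apply/val_inj => /=; apply/eqP.
  by rewrite eqn_leq ni -ltnS ltn_ord.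
have de' i : ns_dom E (e' i) by exact: de.
have [[v0 [Vv0 v0x]]|noV] := pselect (exists v, V v /\ v x != 0); last first.
  have VV' v : V v -> V' v.
    by move=> Vv; split => //; apply: contrapT => /eqP vx; apply: noV; exists v.
  have [v [Vv _] ->] : exists2 v, V' v & F = bicanon (dual E) v.
    apply: (IH e') => //; split => // phi [dphi phi0]; apply: F0; split => // v Vv.
    by apply: phi0; exact: VV'.
  by exists v.
pose v1 : ns_car (dual E) := (v0 x)^-1 *: v0.
have Vv1 : V v1 by rewrite /v1 -[_ *: _]addr0; exact: Vlin.
have v1x : v1 x = 1 by rewrite (_ : v1 x = (v0 x)^-1 * v0 x)// mulVf.
have dv1 := Vdom _ Vv1.
pose xh := bicanon E x.
have dxh : dual_dom (dual E) xh by exact: bicanon_dom.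
(* The coefficient is chosen so that [F' xh = 0], because [v1 x = 1]. *)
pose F' : ns_car (dual (dual (dual E))) := (- F xh) *: bicanon (dual E) v1 + F.
have dF' : dual_dom (dual (dual E)) F'.
  by apply: dual_dom_lin => //; exact: bicanon_dom.
have [v [Vv _] F'v] : exists2 v, V' v & F' = bicanon (dual E) v.
  apply: (IH e') => //; split => // phi [dphi phi0].
  rewrite (_ : F' phi = (- F xh) * bicanon (dual E) v1 phi + F phi)//.
  rewrite bicanonE//.
  (* [psi] annihilates all of [V]: each [u] in [V] is [u x *: v1] plus an element of [V'], on which
     [phi] vanishes. Hence F phi = phi v1 * F xh, that is, F' phi = 0. *)
  pose psi : ns_car (dual (dual E)) := (- phi v1) *: xh + phi.
  have : F psi = 0.
    apply: F0; split; first exact: dual_dom_lin.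
    move=> u Vu; rewrite (_ : psi u = (- phi v1) * xh u + phi u)//.
    have du := Vdom _ Vu.
    rewrite /xh bicanonE//.
    have -> : u = (u x) *: v1 + ((- u x) *: v1 + u).
      by rewrite scaleNr addrA subrr add0r.
    have Vw : V' ((- u x) *: v1 + u).
      split; first exact: Vlin.
      by rewrite (_ : _ x = (- u x) * v1 x + u x)// v1x; ring.
    rewrite (dual_lin _ _ dphi)//; last exact: (Vdom _ Vw.1).
    rewrite (phi0 _ Vw) (_ : _ x = u x * v1 x + ((- u x) * v1 x + u x))// v1x.
    by ring.
  by rewrite (dual_lin _ _ dF)//; lra.
exists (F xh *: v1 + v); first exact: Vlin.
rewrite bicanon_lin//; last exact: Vdom.
rewrite -F'v /F' scaleNr addrA subrr add0r //.
Qed.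

(** Only the nontrivial half of norm additivity is recorded. The other half is the triangle
    inequality, and uniqueness of the decomposition follows from the half stated. *)
Definition L_complement (S : set (ns_car (dual (dual E)))) : Prop :=
  [/\ is_subspace (dual (dual E)) S,
      forall F, dual_dom (dual E) F ->
        exists f s, [/\ ns_dom E f, S s & F = bicanon E f + s] &
      forall f s, ns_dom E f -> S s ->
        ns_norm E f + dual_norm (dual E) s <=
        dual_norm (dual E) (bicanon E f + s)].

End Annihilators.

Section Transfer.
Context {R : realType} (E : nspace R).
Hypothesis nsE : is_nspace E.
Let nsE1 := dual_is_nspace _ nsE.
Let nsE2 := dual_is_nspace _ nsE1.
Let nsE3 := dual_is_nspace _ nsE2.
Local Notation j := (bicanon (dual E)).
Local Notation nm := (dual_norm (dual (dual E))).

(** The difference of the two decompositions is a decomposition of 0, so the norm estimate makes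
    both of its components have norm 0. *)
Lemma L_complement_uniq S f s f' s' : L_complement (dual E) S ->
  dual_dom E f -> dual_dom E f' -> S s -> S s' ->
  j f + s = j f' + s' -> f = f'.
Proof.
move=> [[Sdom [S0 Slin]] _ Snorm] df df' Ss Ss' eq.
have dff : dual_dom E ((-1) *: f' + f : ns_car (dual E)) by exact: dual_dom_lin.
have Sss : S ((-1) *: s' + s) by exact: Slin.
have := Snorm _ _ dff Sss; rewrite bicanon_lin//.
have -> : -1 *: j f' + j f + (-1 *: s' + s) = 0.
  rewrite addrACA -scalerDr -eq scaleN1r; exact: addNr.
have -> : nm 0 = 0 by exact: (ns_norm0 _ nsE3).
have := dual_norm_ge0 _ nsE2 _ (Sdom _ Sss).
move=> /= s0 h.
have /(dual_norm_eq0 _ nsE _ dff) : dual_norm E (-1 *: f' + f : ns_car (dual E)) <= 0.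
  by move: h s0 => /=; lra.
by rewrite scaleN1r addrC => /eqP; rewrite subr_eq0 => /eqP.
Qed.

(** With F = j f + s and g = f - P f, the two vectors to compare are j g + s and j (g + v) + s. The
    strict inequality for g and v survives the addition of the same |s| to both sides, and the other
    inequality only gains room. *)
Lemma property_HB_bidual (V : set (ns_car E)) S :
  L_complement (dual E) S ->
  annihilator (dual (dual E)) (annihilator (dual E) (annihilator E V)) `<=`
    j @` annihilator E V ->
  property_HB E V ->
  property_HB (dual (dual E)) (annihilator (dual E) (annihilator E V)).
Proof.
move=> LS annV [P [Plin [Pid [Pim [Psup Phb]]]]].
have [[Sdom [S0 Slin]] Sdec Snorm] := LS.
have dP f : dual_dom E f -> annihilator E V (P f).
  by move=> df; rewrite -Pim; exists f.
have Pann v : annihilator E V v -> P v = v.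
  by rewrite -Pim => -[f df <-]; exact: Pid.
(* Contractivity of [P] is read off the second inequality of (HB) for f = (f - P f) + P f. *)
have nP f : dual_dom E f -> dual_norm E (P f) <= dual_norm E f.
  move=> df; have [Pf0|Pf0] := pselect (P f = 0).
    rewrite Pf0; apply: le_trans (dual_norm_ge0 _ nsE _ df).
    by apply: dual_norm_le => // x _ _; rewrite normr0.
  have [] := Phb (f - P f) (P f) _ (dP _ df) Pf0; first by exists f.
  by rewrite subrK.
have nj f : dual_dom E f -> nm (j f) = dual_norm E f by exact: bicanon_isometry.
have dj f : dual_dom E f -> dual_dom (dual (dual E)) (j f).
  by move=> df; exact: (bicanon_dom _ nsE1 f df).
have /choice [pi hpi] : forall F, exists f, dual_dom (dual (dual E)) F ->
    dual_dom E f /\ S (F - j f).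
  move=> F; have [dF|ndF] := pselect (dual_dom (dual (dual E)) F); last by exists 0.
  have [f [s [df Ss ->]]] := Sdec F dF.
  by exists f => _; rewrite addrC addKr.
(* [pi] is picked pointwise; its linearity and its values on the image of [j] come from uniqueness
   of the decomposition. *)
have piE F f s : dual_dom E f -> S s -> F = j f + s -> pi F = f.
  move=> df Ss eF; have dF : dual_dom (dual (dual E)) F.
    by rewrite eF; apply: (ns_domD _ nsE3) => /=; [exact: dj|exact: Sdom].
  have [dp Sp] := hpi F dF.
  by apply: (L_complement_uniq S _ (F - j (pi F)) _ s) => //; rewrite addrC subrK.
have pij f : dual_dom E f -> pi (j f) = f.
  by move=> df; apply: (piE _ _ 0) => //; rewrite addr0.
have nF f s : dual_dom E f -> S s -> dual_norm E f + nm s <= nm (j f + s).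
  by exact: Snorm.
exists (fun F => j (P (pi F))); split; [|split; [|split; [|split]]].
- move=> a F G dF dG; have [dp Sp] := hpi F dF; have [dq Sq] := hpi G dG.
  have -> : pi (a *: F + G) = a *: pi F + pi G.
    apply: (piE _ _ (a *: (F - j (pi F)) + (G - j (pi G)))) => //.
    + exact: dual_dom_lin.
    + exact: Slin.
    + rewrite bicanon_lin// addrACA -scalerDr addrC.
      by rewrite [j (pi F) + _]addrC subrK [j (pi G) + _]addrC subrK addrC.
  by rewrite Plin// bicanon_lin//; exact: (dP _ _).1.
- move=> F dF; have [dp _] := hpi F dF.
  by rewrite pij ?Pid//; exact: (dP _ _).1.
- apply/seteqP; split => [_ [F dF <-]|F aF].
    have [dp _] := hpi F dF; have [dPp Pp0] := dP _ dp.
    split; first exact: dj.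
    by move=> phi [dphi phi0]; rewrite bicanonE//; exact: phi0.
  have [v av <-] := annV _ aF.
  have dv := av.1.
  by exists (j v); [exact: dj|rewrite pij// Pann].
- have le1 F : dual_dom (dual (dual E)) F -> nm F <= 1 -> nm (j (P (pi F))) <= 1.
    move=> dF F1; have [dp Sp] := hpi F dF.
    rewrite nj; last exact: (dP _ dp).1.
    apply: le_trans (nP _ dp) _; apply: le_trans F1.
    have := nF _ _ dp Sp; rewrite [j _ + _]addrC subrK; apply: le_trans.
    by rewrite lerDl; apply: (dual_norm_ge0 _ nsE2); exact: Sdom.
  set A := (X in sup X = 1).
  have uA : ubound A 1 by move=> _ [F [dF F1] <-]; exact: le1.
  have A0 : A (nm (j (P (pi 0)))).
    exists 0 => //; split; first exact: dual_dom0.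
    by rewrite (_ : dual_norm _ _ = 0)//; exact: (ns_norm0 _ nsE3).
  apply/eqP; rewrite eq_le; apply/andP; split.
    by apply: ge_sup => //; exists (nm (j (P (pi 0)))).
  (* The supremum is at least 1 because every norm of [P f] occurring in [Psup] recurs as the value
     at [j f]. *)
  rewrite -[leLHS]Psup; apply: ge_sup.
    exists (dual_norm E (P 0)), 0 => //.
    split; first exact: dual_dom0.
    by rewrite (_ : dual_norm _ _ = 0)//; exact: (ns_norm0 _ nsE1).
  move=> _ [f [df f1] <-]; apply: (ub_le_sup (ex_intro _ 1 uA)).
  exists (j f); first by split; [exact: dj|rewrite nj].
  by rewrite pij// nj//; exact: (dP _ _).1.
- move=> G W [F dF <-] aW W0; have [v av vW] := annV _ aW.
  have dv := av.1; have [dp Sp] := hpi F dF; have [dPp _] := dP _ dp.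
  have v0 : v <> 0.
    move=> v0; apply: W0; rewrite -vW v0; apply/funext => phi.
    have [dphi|dphi] := pselect (dual_dom (dual E) phi); last by rewrite bicanon_out.
    by rewrite bicanonE// (dual0 _ nsE1).
  have [lt1 le1] := Phb (pi F - P (pi F)) v (ex_intro2 _ _ (pi F) dp erefl) av v0.
  set g := pi F - P (pi F) in lt1 le1; set s := F - j (pi F) in Sp.
  have dg : dual_dom E g by exact: (ns_domB _ nsE1).
  have ds := Sdom _ Sp.
  have dgv : dual_dom E (g + v) by exact: (ns_domD _ nsE1).
  have eG : F - j (P (pi F)) = j g + s.
    by rewrite /g /s bicanonB// [RHS]addrC addrA subrK.
  have -> : F - j (P (pi F)) + W = j (g + v) + s.
    by rewrite eG -vW (bicanonD (dual E) g v)// addrAC.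
  have ngv := nF _ _ dgv Sp.
  have s0 : 0 <= nm s by exact: (dual_norm_ge0 _ nsE2).
  have ng : nm (j g + s) <= dual_norm E g + nm s.
    by rewrite -nj//; apply: (ns_normD _ nsE3) => //=; exact: dj.
  rewrite eG -vW nj//; move: ngv ng s0 lt1 le1.
  set n1 := nm (j (g + v) + s); set n2 := nm (j g + s); set n3 := nm s.
  set m1 := dual_norm E (g + v); set m2 := dual_norm E g; set m3 := dual_norm E v.
  by lra.
Qed.

End Transfer.

(* For [f] in the dual of [E], the component of [j f] in a norm-additive
   complement of [J^perp] has the same restriction [f] to [E], hence norm at
   least [|f|]; so the other component is 0. *)
Lemma M_ideal_L_complement {R : realType} (E : nspace R) :
  is_nspace E -> M_ideal (dual (dual E)) (bicanon E @` ns_dom E) ->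
  L_complement (dual E) (annihilator (dual (dual E)) (bicanon E @` ns_dom E)).
Proof.
move=> nsE; have nsE1 := dual_is_nspace _ nsE.
have nsE2 := dual_is_nspace _ nsE1; have nsE3 := dual_is_nspace _ nsE2.
set J := (X in M_ideal _ X).
move=> [_ [_ [W [[Wdom [W0 Wlin]] [_ [JW [dec nrm]]]]]]].
have jW f : dual_dom E f -> W (bicanon (dual E) f).
  move=> df; have djf : dual_dom (dual (dual E)) (bicanon (dual E) f).
    exact: (bicanon_dom _ nsE1 f df).
  have [u [w [au [Ww e]]]] := dec _ djf.
  have dw := Wdom _ Ww.
  have fw : dual_norm E f <= dual_norm (dual (dual E)) w.
    apply: dual_norm_le => // x dx x1.
    have djx : dual_dom (dual E) (bicanon E x) by exact: (bicanon_dom _ nsE x dx).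
    have ux : u (bicanon E x) = 0 by apply: au.2; exists x.
    rewrite -(bicanonE _ x f df) -(bicanonE (dual E) f _ djx) e.
    rewrite (_ : (u + w) _ = u (bicanon E x) + w (bicanon E x))// ux add0r.
    apply: (dual_norm_ub1 _ nsE2 _ dw) => //=.
    by apply: le_trans x1; exact: bicanon_norm_le.
  have u0 : u = 0.
    apply: (dual_norm_eq0 _ nsE2 _ au.1).
    have := nrm u w au Ww; rewrite -e bicanon_isometry//; lra.
  by rewrite e u0 add0r.
split.
- exact: annihilator_subspace.
- move=> F dF; have [u [w [au [Ww e]]]] := dec _ dF.
  have dw := Wdom _ Ww.
  (* [f] is the restriction of [w] to [E]. The difference of [w] and the image of [f] lies in [W]
     and vanishes on [E], so [JW] makes it 0. *)
  pose f : ns_car (dual E) :=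
    fun x => if `[< ns_dom E x >] then w (bicanon E x) else 0.
  have fE x : ns_dom E x -> f x = w (bicanon E x).
    by move=> dx; rewrite /f asboolT.
  have dj x : ns_dom E x -> dual_dom (dual E) (bicanon E x).
    by move=> dx; exact: (bicanon_dom _ nsE x dx).
  have df : dual_dom E f.
    apply: (dual_domI _ _ (dual_norm (dual (dual E)) w)) => [x dx|a x y dx dy|x dx].
    + by rewrite /f asboolF.
    + rewrite !fE//; last exact: (ns_domP _ nsE).
      by rewrite bicanon_lin// (dual_lin _ _ dw)//; exact: dj.
    + rewrite fE//; apply: le_trans (dual_norm_ub _ nsE2 _ dw _ (dj _ dx)) _.
      by rewrite ler_wpM2l ?(dual_norm_ge0 _ nsE2)//; exact: bicanon_norm_le.
  exists f, u; split => //; rewrite e addrC; congr (_ + _).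
  apply/eqP; rewrite -subr_eq0; apply/eqP; apply: JW; last first.
    by rewrite addrC -scaleN1r; apply: Wlin => //; exact: jW.
  have djf : dual_dom (dual (dual E)) (bicanon (dual E) f).
    exact: (bicanon_dom _ nsE1 f df).
  split; first exact: (ns_domB _ nsE3).
  move=> _ [x dx <-].
  rewrite (_ : (_ - _) _ = w (bicanon E x) - bicanon (dual E) f (bicanon E x))//.
  rewrite bicanonE ?bicanonE//; last exact: dj.
  by rewrite fE// subrr.
- move=> f s df as_; rewrite addrC [bicanon _ _ + _]addrC nrm//; last exact: jW.
  by rewrite bicanon_isometry// addrC.
Qed.

(** A functional vanishing on [Y] is determined by its values at the finitely many vectors spanning
    [X] modulo [Y]. These are the separating points required by [finite_dim_weak_star_closed]. *)
Lemma property_HB_finite_codim {R : realType} (X : normedModType R) (Y : set X) S :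
  L_complement (dual (nspace_of X)) S ->
  finite_codim_closed_subspace X Y ->
  property_HB (nspace_of X) Y ->
  property_HB (dual (dual (nspace_of X)))
    (annihilator (dual (nspace_of X)) (annihilator (nspace_of X) Y)).
Proof.
have nsX := nspace_of_is_nspace X.
move=> LS [_ [_ [_ [n [e he]]]]]; apply: (property_HB_bidual _ nsX _ S) => // F aF.
have [v av ->] : exists2 v, annihilator (nspace_of X) Y v &
    F = bicanon (dual (nspace_of X)) v.
  apply: (finite_dim_weak_star_closed _ nsX n e) => //.
    exact: annihilator_subspace.
  move=> v [dv v0] ve; apply/funext => x; have [y [c [Yy ->]]] := he x.
  rewrite (dualD _ _ dv)// (v0 y Yy) add0r.
  elim/big_rec: _ => [|i z _ vz]; first exact: (dual0 _ nsX _ dv).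
  by rewrite (dual_lin _ _ dv)// ve mulr0 add0r.
by exists v.
Qed.

(** * Riesz-Kantorovich theory for ordered normed spaces *)

(* Norms are compared up to constants, which is all that order boundedness of
   functionals requires and is inherited by duals. *)
Record is_riesz {R : realType} (E : nspace R) (pos : set (ns_car E)) : Prop :=
  IsRiesz {
  riesz_ns : is_nspace E;
  pos_dom : forall x, pos x -> ns_dom E x;
  pos0 : pos 0;
  posD : forall x y, pos x -> pos y -> pos (x + y);
  posZ : forall a x, 0 <= a -> pos x -> pos (a *: x);
  pos_generating : exists2 C, 0 <= C & forall x, ns_dom E x ->
    exists a b, [/\ pos a /\ pos b, x = a - b, ns_norm E a <= C * ns_norm E x &
      ns_norm E b <= C * ns_norm E x];
  pos_normal : exists2 C, 0 <= C & forall a b, pos a -> pos (b - a) ->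
    ns_norm E a <= C * ns_norm E b;
  pos_decomp : forall x a b, pos x -> pos a -> pos b -> pos (a + b - x) ->
    exists y, [/\ pos y, pos (x - y), pos (a - y) & pos (b - (x - y))] }.

Definition dual_pos {R : realType} (E : nspace R) (pos : set (ns_car E)) :
    set (ns_car (dual E)) :=
  [set f | dual_dom E f /\ forall x, pos x -> 0 <= f x].

Section RieszKantorovich.
Context {R : realType} (E : nspace R) (pos : set (ns_car E)).
Hypothesis rE : is_riesz E pos.
Let nsE := riesz_ns _ _ rE.
Let nsE1 := dual_is_nspace _ nsE.

Section PositivePart.
Variables (C M : R) (G : ns_car (dual E)).
Hypotheses (C0 : 0 <= C) (M0 : 0 <= M) (dG : dual_dom E G).
Hypothesis hC : forall x, ns_dom E x ->
  exists a b, [/\ pos a /\ pos b, x = a - b, ns_norm E a <= C * ns_norm E x &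
    ns_norm E b <= C * ns_norm E x].
Hypothesis hM : forall a b, pos a -> pos (b - a) ->
  ns_norm E a <= M * ns_norm E b.

(** The Riesz-Kantorovich formula for the positive part of [G], meaningful on the cone only. *)
Let q (x : ns_car E) : R := sup [set G y | y in [set y | pos y /\ pos (x - y)]].

Let q_bound x y : pos y -> pos (x - y) ->
  `|G y| <= M * dual_norm E G * ns_norm E x.
Proof.
move=> py pxy.
have dy := pos_dom _ _ rE _ py.
apply: le_trans (dual_norm_ub _ nsE _ dG _ dy) _.
rewrite [M * _]mulrC -mulrA ler_wpM2l ?(dual_norm_ge0 _ nsE)//.
exact: hM.
Qed.

Let q_ub x y : pos y -> pos (x - y) -> G y <= q x.
Proof.
move=> py pxy.
rewrite /q; apply: ub_le_sup; last by exists y.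
exists (M * dual_norm E G * ns_norm E x) => _ [z [pz pxz] <-].
by apply: le_trans (q_bound _ _ pz pxz); exact: ler_norm.
Qed.

Let q_le x c : pos x -> (forall y, pos y -> pos (x - y) -> G y <= c) -> q x <= c.
Proof.
move=> px h; apply: ge_sup; last by move=> _ [y [py pxy] <-]; exact: h.
by exists (G 0), 0 => //; split; [exact: pos0|rewrite subr0].
Qed.

Let q_ge0 x : pos x -> 0 <= q x.
Proof.
move=> px; rewrite -[leLHS](dual0 _ nsE _ dG); apply: q_ub; first exact: pos0.
by rewrite subr0.
Qed.

Let q_adh x eps : pos x -> 0 < eps ->
  exists y, [/\ pos y, pos (x - y) & q x - eps < G y].
Proof.
move=> px e0; apply: contrapT => h.
suff : q x <= q x - eps by lra.
apply: q_le => // y py pxy; rewrite leNgt; apply/negP => hlt.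
by apply: h; exists y.
Qed.

(** Subadditivity is the Riesz decomposition property: any 0 <= z <= x + y splits into pieces below
    [x] and below [y]. Superadditivity adds near-maximizers. *)
Let qD x y : pos x -> pos y -> q (x + y) = q x + q y.
Proof.
move=> px py; apply/eqP; rewrite eq_le; apply/andP; split.
  apply: q_le => [|z pz pxyz]; first exact: (posD _ _ rE).
  have [u [pu pzu pxu pyu]] := pos_decomp _ _ rE _ _ _ pz px py pxyz.
  have -> : z = u + (z - u) by rewrite addrC subrK.
  rewrite (dualD _ _ dG); [|exact: (pos_dom _ _ rE)..].
  by rewrite lerD// q_ub.
apply/ler_addgt0Pr => eps e0.
have e2 : 0 < eps / 2 by rewrite divr_gt0.
have [u [pu pxu hu]] := q_adh x _ px e2.
have [v [pv pyv hv]] := q_adh y _ py e2.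
have : G (u + v) <= q (x + y).
  apply: q_ub; first exact: (posD _ _ rE).
  by rewrite opprD addrACA; exact: (posD _ _ rE).
rewrite (dualD _ _ dG); [|exact: (pos_dom _ _ rE)..].
by lra.
Qed.

Let q0 : q 0 = 0.
Proof.
by have := qD 0 0 (pos0 _ _ rE) (pos0 _ _ rE); rewrite addr0; lra.
Qed.

Let qZ_le a x : 0 < a -> pos x -> a * q x <= q (a *: x).
Proof.
move=> a0 px; rewrite mulrC -ler_pdivlMr//; apply: q_le => // y py pxy.
rewrite ler_pdivlMr// mulrC -(dualZ _ nsE _ dG); last exact: (pos_dom _ _ rE).
apply: q_ub; first by apply: (posZ _ _ rE) => //; exact: ltW.
by rewrite -scalerBr; apply: (posZ _ _ rE) => //; exact: ltW.
Qed.

Let qZ a x : 0 <= a -> pos x -> q (a *: x) = a * q x.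
Proof.
rewrite le_eqVlt => /predU1P[<- _|a0 px]; first by rewrite scale0r q0 mul0r.
apply/eqP; rewrite eq_le qZ_le// andbT.
have pax : pos (a *: x) by apply: (posZ _ _ rE) => //; exact: ltW.
have ia : 0 < a^-1 by rewrite invr_gt0.
have := qZ_le _ _ ia pax; rewrite scalerA mulVf ?gt_eqF// scale1r.
by rewrite mulrC ler_pdivrMr// mulrC.
Qed.

Lemma positive_part_subproof : exists K, [/\ dual_pos E pos K,
  dual_pos E pos (K - G),
  forall x eps, pos x -> 0 < eps ->
    exists y, [/\ pos y, pos (x - y) & K x - eps < G y] &
  dual_norm E K <= 2 * M * C * dual_norm E G].
Proof.
have /choice[p hp] : forall x, exists p, ns_dom E x ->
    [/\ pos p, pos (p - x), ns_norm E p <= C * ns_norm E x &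
        ns_norm E (p - x) <= C * ns_norm E x].
  move=> x; have [dx|] := pselect (ns_dom E x); last by exists 0.
  have [a [b [[pa pb] e na nb]]] := hC x dx; exists a => _.
  by have -> : a - x = b by rewrite e opprB addrC subrK.
pose K : ns_car (dual E) := fun x => if `[< ns_dom E x >] then q (p x) - q (p x - x) else 0.
(* Independence of the chosen decomposition: both ways of writing the same vector as a difference
   give equal cross sums, and [q] is additive. *)
have KE a b : pos a -> pos b -> K (a - b) = q a - q b.
  move=> pa pb; have da := pos_dom _ _ rE _ pa; have db := pos_dom _ _ rE _ pb.
  have dab : ns_dom E (a - b) by exact: (ns_domB _ nsE).
  rewrite /K asboolT//; have [pp pn _ _] := hp _ dab.
  have := qD _ _ pp pb; have := qD _ _ pn pa.
  have -> : p (a - b) + b = p (a - b) - (a - b) + a.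
    by rewrite opprB addrA subrK.
  by lra.
have Kpos x : pos x -> K x = q x.
  by move=> px; rewrite -[x]subr0 KE ?q0 ?subr0//; exact: (pos0 _ _ rE).
have dec x : ns_dom E x -> exists a b, [/\ pos a, pos b & x = a - b].
  move=> dx; have [pp pn _ _] := hp x dx.
  by exists (p x), (p x - x); split => //; rewrite opprB addrC subrK.
have KZ a x : ns_dom E x -> K (a *: x) = a * K x.
  move=> /dec[u [v [pu pv ->]]]; rewrite KE//.
  have [a0|a0] := leP 0 a.
    by rewrite scalerBr KE ?qZ//; [ring|exact: (posZ _ _ rE)..].
  have na : 0 <= - a by lra.
  have -> : a *: (u - v) = (- a) *: v - (- a) *: u.
    by rewrite scalerBr !scaleNr opprK addrC.
  by rewrite KE ?qZ//; [ring|exact: (posZ _ _ rE)..].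
have KD x y : ns_dom E x -> ns_dom E y -> K (x + y) = K x + K y.
  move=> /dec[u [v [pu pv ->]]] /dec[u' [v' [pu' pv' ->]]].
  rewrite addrACA -opprD (KE (u + u') (v + v')) ?KE ?qD//; [|exact: (posD _ _ rE)..].
  by ring.
have Kle x : ns_dom E x -> `|K x| <= (2 * M * C) * dual_norm E G * ns_norm E x.
  move=> dx; have [pp pn np nn] := hp x dx.
  (* [M] bounds the order interval below [y] by the norm of [y], and [C] bounds the chosen parts by
     the norm of [x]; the factor 2 in [Kle] allows for two such terms. *)
  have qb y : pos y -> ns_norm E y <= C * ns_norm E x ->
      0 <= q y <= M * C * dual_norm E G * ns_norm E x.
    move=> py ny; rewrite q_ge0//=; apply: q_le => // z pz pyz.
    apply: le_trans (ler_norm _) _; apply: le_trans (q_bound _ _ pz pyz) _.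
    rewrite [M * C]mulrC -!mulrA [C * _]mulrC -!mulrA.
    rewrite ler_wpM2l// ler_wpM2l ?(dual_norm_ge0 _ nsE)//.
    by rewrite mulrC.
  have /andP[a1 a2] := qb _ pp np; have /andP[b1 b2] := qb _ pn nn.
  rewrite /K asboolT// ler_norml.
  by move: a1 a2 b1 b2; set t := M * C * _ * _;
    rewrite (_ : 2 * M * C * dual_norm E G * ns_norm E x = 2 * t);
    [lra|rewrite /t; ring].
have dK : dual_dom E K.
  apply: (dual_domI _ _ (2 * M * C * dual_norm E G)) => // [x dx|a x y dx dy].
    by rewrite /K asboolF.
  by rewrite KD ?KZ//; exact: (ns_domZ _ nsE).
exists K; split.
- by split => // x px; rewrite Kpos ?q_ge0.
- split; first exact: (ns_domB _ nsE1).
  move=> x px; rewrite (_ : (K - G) x = K x - G x)// Kpos// subr_ge0.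
  by apply: q_ub => //; rewrite subrr; exact: pos0.
- by move=> x eps px e0; rewrite Kpos//; exact: q_adh.
- have CC : 0 <= 2 * M * C * dual_norm E G.
    by rewrite !mulr_ge0// (dual_norm_ge0 _ nsE).
  apply: dual_norm_le => // x dx x1; apply: le_trans (Kle _ dx) _.
  by rewrite -[leRHS]mulr1 ler_wpM2l.
Qed.

End PositivePart.

(** [K] is the positive part of [G]. The clause with [eps] keeps the supremum formula: it yields
    minimality of [K], and later the functional [chi] that witnesses singularity. *)
Lemma dual_positive_part : exists2 C, 0 <= C & forall G, dual_dom E G ->
  exists K, [/\ dual_pos E pos K,
    dual_pos E pos (K - G),
    forall x eps, pos x -> 0 < eps ->
      exists y, [/\ pos y, pos (x - y) & K x - eps < G y] &
    dual_norm E K <= C * dual_norm E G].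
Proof.
have [C C0 hC] := pos_generating _ _ rE; have [M M0 hM] := pos_normal _ _ rE.
exists (2 * M * C); first by rewrite !mulr_ge0.
by move=> G dG; exact: positive_part_subproof.
Qed.

(** For the approximating [y] one has H x >= H y >= G y > K x - eps, the first step since [H] is
    positive and y <= x. *)
Lemma dual_positive_part_min G K H : dual_dom E G -> dual_dom E K ->
  (forall x eps, pos x -> 0 < eps ->
    exists y, [/\ pos y, pos (x - y) & K x - eps < G y]) ->
  dual_pos E pos H -> dual_pos E pos (H - G) -> dual_pos E pos (H - K).
Proof.
move=> dG dK hK [dH H0] [_ HG]; split; first exact: (ns_domB _ nsE1).
move=> x px; rewrite (_ : (H - K) x = H x - K x)// subr_ge0.
apply/ler_addgt0Pr => eps e0; have [y [py pxy hy]] := hK _ _ px e0.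
have := HG _ py; rewrite (_ : (H - G) y = H y - G y)//.
have := H0 _ pxy; rewrite (dualB _ nsE _ dH); [|exact: (pos_dom _ _ rE)..].
lra.
Qed.

Lemma dual_riesz : is_riesz (dual E) (dual_pos E pos).
Proof.
split => //.
- by move=> f [].
- by split => //; exact: dual_dom0.
- move=> f g [df f0] [dg g0]; split; first exact: (ns_domD _ nsE1).
  by move=> x px; rewrite (_ : (f + g) x = f x + g x)// addr_ge0 ?f0 ?g0.
- move=> a f a0 [df f0]; split; first exact: (ns_domZ _ nsE1).
  by move=> x px; rewrite (_ : (a *: f) x = a * f x)// mulr_ge0 ?f0.
- have [C C0 hC] := dual_positive_part.
  (* The summand 1 pays for [G] itself in the negative part [K - G]. *)
  exists (C + 1); first by rewrite addr_ge0.
  move=> G dG; have [K [pK pKG _ nK]] := hC G dG.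
  exists K, (K - G); have nG : 0 <= dual_norm E G by exact: dual_norm_ge0.
  split => //; first by rewrite opprB addrC subrK.
    by rewrite mulrDl mul1r; apply: le_trans nK _; rewrite lerDl.
  rewrite mulrDl mul1r; apply: le_trans (ns_normB _ nsE1 _ _ pK.1 dG) _.
  by rewrite lerD.
- have [C C0 hC] := pos_generating _ _ rE.
  (* Order comparison controls values on the cone only, so [x] is split into two positive parts,
     each of norm at most [C]. *)
  exists (2 * C); first by rewrite mulr_ge0.
  move=> f g [df f0] [dgf gf0]; have dg : dual_dom E g.
    by rewrite -[g](subrK f); exact: (ns_domD _ nsE1).
  have g0 : 0 <= dual_norm E g by exact: dual_norm_ge0.
  apply: dual_norm_le => // x dx x1.
  have [a [b [[pa pb] e na nb]]] := hC x dx.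
  have le y : pos y -> ns_norm E y <= C * ns_norm E x ->
      0 <= f y <= C * dual_norm E g.
    move=> py ny; rewrite f0//=; apply: (@le_trans _ _ (g y)).
      by have := gf0 _ py; rewrite (_ : (g - f) y = g y - f y)// subr_ge0.
    apply: le_trans (ler_norm _) _.
    apply: le_trans (dual_norm_ub _ nsE _ dg _ (pos_dom _ _ rE _ py)) _.
    rewrite mulrC ler_wpM2r//; apply: le_trans ny _.
    by rewrite -[leRHS]mulr1 ler_wpM2l.
  rewrite e (dualB _ nsE _ df); [|exact: (pos_dom _ _ rE)..].
  have /andP[] := le _ pa na; have /andP[] := le _ pb nb.
  rewrite -mulrA ler_norml; set t := C * _; lra.
- move=> h a b ph pa pb pabh.
  have [C C0 hC] := dual_positive_part.
  have dha : dual_dom E (h - a) by exact: (ns_domB _ nsE1 _ _ ph.1 pa.1).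
  have [K [pK pKG hK _]] := hC _ dha.
  (* Since [K] is the positive part of h - a, this is the infimum of [h] and [a]. Minimality of [K]
     against [h] gives its positivity, and minimality against [b] bounds the remainder [K] by
     [b]. *)
  exists (h - K); split.
  + apply: (dual_positive_part_min _ _ _ dha pK.1 hK) => //.
    by rewrite subKr.
  + by rewrite subKr.
  + by rewrite opprB addrCA -opprB.
  + rewrite subKr.
    apply: (dual_positive_part_min _ _ _ dha pK.1 hK) => //.
    by rewrite opprB addrA [b + a]addrC.
Qed.

End RieszKantorovich.

(** * Abstract L-spaces are L-summands of their biduals *)

(** The tails of a disjoint union decrease to the empty set, so continuity there upgrades finite
    additivity to countable additivity; [k] is then a finite charge and has a Hahn decomposition. *)
Lemma Hahn_real {d} {T : measurableType d} {R : realType} (k : set T -> R) :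
  (forall A B, measurable A -> measurable B -> A `&` B = set0 ->
    k (A `|` B) = k A + k B) ->
  (forall A : nat -> set T, (forall n, measurable (A n)) ->
    (forall n, A n.+1 `<=` A n) -> \bigcap_n A n = set0 ->
    (k \o A) @ \oo --> 0) ->
  exists P, [/\ measurable P,
    forall A, measurable A -> A `<=` P -> 0 <= k A &
    forall A, measurable A -> A `<=` ~` P -> k A <= 0].
Proof.
move=> kD kcont.
have k0 : k set0 = 0.
  have := kD set0 set0 measurable0 measurable0 (setI0 _); rewrite setU0; lra.
pose nu0 (A : set T) : \bar R := (k A)%:E.
have nu00 : nu0 set0 = 0%E by rewrite /nu0 k0.
have nu0fin A : measurable A -> nu0 A \is a fin_num by [].
have nu0s : semi_sigma_additive nu0.
  move=> F mF tF mUF.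
  have mU n : measurable (\big[setU/set0]_(0 <= i < n) F i).
    by rewrite big_mkord; exact: bigsetU_measurable.
  have sumE n : (\sum_(0 <= i < n) nu0 (F i))%E =
      (k (\big[setU/set0]_(0 <= i < n) F i))%:E.
    elim: n => [|n IH]; first by rewrite !big_nil // k0.
    rewrite !big_nat_recr//= IH -EFinD; congr EFin; rewrite kD//.
    rewrite big_mkord; apply/seteqP; split => // t [].
    rewrite -bigcup_mkord => -[i /= ilt Fi] Fn.
    have e := tF i n Logic.I Logic.I (ex_intro _ t (conj Fi Fn)).
    by move: ilt; rewrite e ltnn.
  pose A n := \bigcup_i F i `\` \big[setU/set0]_(0 <= i < n) F i.
  have mA n : measurable (A n) by exact: measurableD.
  have splitE n : k (\big[setU/set0]_(0 <= i < n) F i) = k (\bigcup_i F i) - k (A n).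
    rewrite [in X in _ = X - _](_ : \bigcup_i F i =
      \big[setU/set0]_(0 <= i < n) F i `|` A n).
      rewrite kD//; first by rewrite addrK.
      by apply/seteqP; split => // t [? []].
    rewrite /A setDUK// big_mkord -bigcup_mkord.
    by move=> t [i _ Fi]; exists i.
  rewrite (_ : (fun n => _) = EFin \o (fun n => k (\bigcup_i F i) - k (A n))); last first.
    by apply/funext => n /=; rewrite sumE splitE.
  apply/cvg_EFin; first by exact: nearW.
  rewrite -[X in _ --> X]subr0; apply: cvgB; first exact: cvg_cst.
  apply: kcont => //.
    move=> n t [Ut nUt]; split => //; apply: contra_not nUt.
    by rewrite big_nat_recr//=; left.
  apply/seteqP; split => // t h; have [[i _ Fi] _] := h 0%N Logic.I.
  have [_] := h i.+1 Logic.I; apply.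
  by rewrite big_nat_recr//=; right.
pose nu : {charge set T -> \bar R} := HB.pack_for (charge T R) nu0
  (isCharge.Build _ _ _ nu0 nu00 nu0fin nu0s).
have [P [N [[mP hP] [mN hN] PN PN0]]] := Hahn_decomposition nu.
exists P; split; [exact: mP|exact: hP|move=> A mA AP].
have AN : A `<=` N.
  move=> t At; have : (P `|` N) t by rewrite PN.
  by case=> // Pt; case: (AP t At Pt).
exact: hN.
Qed.

Section DualEval.
Context {R : realType} (E : nspace R).
Implicit Types (f g : ns_car (dual E)) (x : ns_car E).

Lemma dual_evalD f g x : (f + g) x = f x + g x. Proof. by []. Qed.
Lemma dual_evalN f x : (- f) x = - f x. Proof. by []. Qed.
Lemma dual_evalB f g x : (f - g) x = f x - g x. Proof. by []. Qed.
Lemma dual_evalZ (a : R) f x : (a *: f) x = a * f x. Proof. by []. Qed.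

End DualEval.

(** The limit that closes both halving arguments below. *)
Lemma halving_ge0 {R : realType} (u c : R) : 0 <= c -> (forall k : nat, - (c * 2^-1 ^+ k) <= u) -> 0 <= u.
Proof.
move=> c0 h; have l : (fun k : nat => - (c * 2^-1 ^+ k)) @ \oo --> - (c * 0 : R).
  apply: cvgN; apply: cvgM; first exact: cvg_cst.
  by apply: cvg_expr; rewrite ger0_norm; lra.
rewrite mulr0 oppr0 in l.
by apply: (cvgr_to_le l); exact: nearW.
Qed.

(* The features of L_1 as a lattice with order unit [I] (the integral) in its
   dual, [M A] being multiplication by the indicator function of [A].  In
   [al_support], [B] is the set where [e] does not vanish. *)
Record is_al_space {R : realType} (E : nspace R) {d} {T : measurableType d}
    (pos : set (ns_car E)) (I : ns_car (dual E))
    (M : set T -> ns_car E -> ns_car E) : Prop := IsAL {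
  al_riesz : is_riesz E pos;
  al_I : dual_dom E I;
  al_I_le : forall f, ns_dom E f -> I f <= ns_norm E f;
  al_posP : forall f, ns_dom E f -> ns_norm E f <= I f -> pos f;
  al_posI : forall f, pos f -> ns_norm E f <= I f;
  al_M_dom : forall A f, measurable A -> ns_dom E f -> ns_dom E (M A f);
  al_M_out : forall A f, ~ ns_dom E f -> M A f = 0;
  al_M_lin : forall A a f g, measurable A -> ns_dom E f -> ns_dom E g ->
    M A (a *: f + g) = a *: M A f + M A g;
  al_M_pos : forall A f, measurable A -> pos f -> pos (M A f);
  al_MM : forall A B f, measurable A -> measurable B -> ns_dom E f ->
    M A (M B f) = M (A `&` B) f;
  al_MC : forall A f, measurable A -> ns_dom E f -> f = M A f + M (~` A) f;
  al_M_norm : forall A f, measurable A -> ns_dom E f ->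
    ns_norm E f = ns_norm E (M A f) + ns_norm E (M (~` A) f);
  al_M_cvg : forall (A : nat -> set T) f, ns_dom E f ->
    (forall n, measurable (A n)) -> (forall n, A n.+1 `<=` A n) ->
    \bigcap_n A n = set0 -> (fun n => ns_norm E (M (A n) f)) @ \oo --> (0 : R);
  al_hahn : forall f, ns_dom E f ->
    exists A, [/\ measurable A, pos (M A f) & pos (- M (~` A) f)];
  al_support : forall e, pos e -> exists B, [/\ measurable B, M B e = e &
    forall f eps, pos f -> M B f = f -> 0 < eps -> exists A r,
      [/\ measurable A, 0 < r, pos (r *: e - M (~` A) f) &
          ns_norm E (M A f) <= eps]];
  al_complete : forall (f : nat -> ns_car E) (C : R), (forall n, pos (f n)) ->
    (forall n, pos (f n.+1 - f n)) -> (forall n, ns_norm E (f n) <= C) ->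
    exists g, ns_dom E g /\ forall eps, 0 < eps -> exists n0, forall n,
      (n0 <= n)%N -> ns_norm E (g - f n) <= eps }.

(** * Restriction of functionals to measurable sets, and minorants in [E] *)

Section ALSpace.
Context {R : realType} (E : nspace R) {d} {T : measurableType d}.
Context (pos : set (ns_car E)) (I : ns_car (dual E)).
Context (M : set T -> ns_car E -> ns_car E).
Hypothesis alE : is_al_space E pos I M.
Let rE := al_riesz _ _ _ _ alE.
Let nsE := riesz_ns _ _ rE.
Let nsE1 := dual_is_nspace _ nsE.
Let nsE2 := dual_is_nspace _ nsE1.
Let rE1 := dual_riesz _ _ rE.
Let rE2 := dual_riesz _ _ rE1.
Local Notation dpos := (dual_pos E pos).
Local Notation ddpos := (dual_pos (dual E) dpos).
Local Notation N := (ns_norm E).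
Local Notation j := (bicanon E).
Let Mdom := al_M_dom _ _ _ _ alE.
Let pdom := pos_dom _ _ rE.
Let dI := al_I _ _ _ _ alE.
Implicit Types (A B P : set T) (e f g x y : ns_car E) (psi chi : ns_car (dual E)).

(** The adjoint of [M A]: it stands for the product of [psi] with an indicator, without representing
    [psi] by a function. *)
Definition comp_M psi A : ns_car (dual E) := fun f => psi (M A f).

Lemma al_M_norm_le A f : measurable A -> ns_dom E f -> N (M A f) <= N f.
Proof.
move=> mA df; rewrite [leRHS](al_M_norm _ _ _ _ alE A)// lerDl.
by apply: (ns_norm_ge0 _ nsE); apply: Mdom => //; exact: measurableC.
Qed.

Lemma al_normE f : pos f -> N f = I f.
Proof.
move=> pf; apply/eqP; rewrite eq_le (al_posI _ _ _ _ alE)//=.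
by apply: (al_I_le _ _ _ _ alE); exact: pdom.
Qed.

Lemma al_MB A f g : measurable A -> ns_dom E f -> ns_dom E g ->
  M A (f - g) = M A f - M A g.
Proof.
by move=> mA df dg; rewrite addrC -scaleN1r (al_M_lin _ _ _ _ alE)// scaleN1r addrC.
Qed.

Lemma al_MD A f g : measurable A -> ns_dom E f -> ns_dom E g ->
  M A (f + g) = M A f + M A g.
Proof.
by move=> mA df dg; rewrite -{1}[f]scale1r (al_M_lin _ _ _ _ alE)// scale1r.
Qed.

Lemma al_MZ A a f : measurable A -> ns_dom E f -> M A (a *: f) = a *: M A f.
Proof.
move=> mA df; have d0 := ns_dom0 _ nsE.
have M0 : M A 0 = 0.
  by rewrite -{1}(subrr f) al_MB// subrr.
by rewrite -[a *: f]addr0 (al_M_lin _ _ _ _ alE)// M0 addr0.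
Qed.

Lemma comp_M_dom psi A : dual_dom E psi -> measurable A ->
  dual_dom E (comp_M psi A).
Proof.
move=> dpsi mA; apply: (dual_domI _ _ (dual_norm E psi)) => [f df|a f g df dg|f df].
- by rewrite /comp_M (al_M_out _ _ _ _ alE)// (dual0 _ nsE _ dpsi).
- by rewrite /comp_M (al_M_lin _ _ _ _ alE)// (dual_lin _ _ dpsi)//; exact: Mdom.
- apply: le_trans (dual_norm_ub _ nsE _ dpsi _ (Mdom _ _ mA df)) _.
  by rewrite ler_wpM2l ?(dual_norm_ge0 _ nsE)//; exact: al_M_norm_le.
Qed.

Lemma comp_M_pos psi A : dpos psi -> measurable A -> dpos (comp_M psi A).
Proof.
move=> [dpsi p0] mA; split; first exact: comp_M_dom.
by move=> f pf; apply: p0; exact: (al_M_pos _ _ _ _ alE).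
Qed.

Lemma comp_MC psi A : dual_dom E psi -> measurable A ->
  psi = comp_M psi A + comp_M psi (~` A).
Proof.
move=> dpsi mA; apply/funext => f; rewrite dual_evalD /comp_M.
have mA' := measurableC mA.
have [df|df] := pselect (ns_dom E f); last first.
  by rewrite !(al_M_out _ _ _ _ alE)// (dual0 _ nsE _ dpsi) (dual_out _ _ dpsi)// addr0.
by rewrite {1}(al_MC _ _ _ _ alE A f mA df) (dualD _ _ dpsi)//; exact: Mdom.
Qed.

Lemma comp_MM psi A B : dual_dom E psi -> measurable A -> measurable B ->
  comp_M (comp_M psi A) B = comp_M psi (A `&` B).
Proof.
move=> dpsi mA mB; apply/funext => f; rewrite /comp_M.
have [df|df] := pselect (ns_dom E f); first by rewrite (al_MM _ _ _ _ alE).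
have M0 : M A 0 = 0.
  by have := al_MZ A 0 0 mA (ns_dom0 _ nsE); rewrite !scale0r.
by rewrite !(al_M_out _ _ _ _ alE _ f)// M0.
Qed.

Lemma al_M_setU A B f : measurable A -> measurable B -> A `&` B = set0 ->
  ns_dom E f -> M (A `|` B) f = M A f + M B f.
Proof.
move=> mA mB AB df.
have mAB : measurable (A `|` B) by exact: measurableU.
rewrite (al_MC _ _ _ _ alE A (M (A `|` B) f))//; last exact: Mdom.
have mA' := measurableC mA.
rewrite !(al_MM _ _ _ _ alE)//.
have -> : A `&` (A `|` B) = A by apply/seteqP; split => [t []|t At] //; split => //; left.
congr (_ + M _ f).
apply/seteqP; split => [t [nA []//]|t Bt].
split; last by right.
by move=> At; have : (A `&` B) t by []; rewrite AB.
Qed.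

Lemma al_M_additive psi f A B : dual_dom E psi -> ns_dom E f ->
  measurable A -> measurable B -> A `&` B = set0 ->
  psi (M (A `|` B) f) = psi (M A f) + psi (M B f).
Proof.
by move=> dpsi df mA mB AB; rewrite al_M_setU// (dualD _ _ dpsi)//; exact: Mdom.
Qed.

(** Domination by the norm of [M A f] turns [al_M_cvg] into the continuity at the empty set asked
    for by [Hahn_real]. *)
Lemma al_Hahn (k : set T -> R) f C :
  (forall A B, measurable A -> measurable B -> A `&` B = set0 ->
    k (A `|` B) = k A + k B) ->
  ns_dom E f -> (forall A, measurable A -> `|k A| <= C * N (M A f)) ->
  exists P, [/\ measurable P,
    forall A, measurable A -> A `<=` P -> 0 <= k A &
    forall A, measurable A -> A `<=` ~` P -> k A <= 0].
Proof.
move=> kD df kle; apply: Hahn_real => // A mA decA capA.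
have h := al_M_cvg _ _ _ _ alE A f df mA decA capA.
have : (fun n => C * N (M (A n) f)) @ \oo --> C * 0.
  by apply: cvgM => //; exact: cvg_cst.
rewrite mulr0 => h'.
apply: norm_cvg0.
have sq : \forall n \near \oo, 0 <= `|k (A n)| <= C * N (M (A n) f).
  by apply: nearW => n; rewrite normr_ge0/= kle.
exact: (squeeze_cvgr sq (@cvg_cst _ _ _ _ _) h').
Qed.

Let Mpos := al_M_pos _ _ _ _ alE.
Let pD := posD _ _ rE.
Let pZ := posZ _ _ rE.

(* Each step replaces [f] by [f'] with [2f = M_Q e + f'] and [0 <= f' <= e],
   where [Q] is the set on which [f >= e/2]. *)
Lemma al_half_hahn psi e P f : dual_dom E psi -> pos e -> measurable P ->
  (forall A, measurable A -> A `<=` P -> 0 <= psi (M A e)) ->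
  pos f -> pos (e - f) -> 0 <= psi (M P f).
Proof.
move=> dpsi pe mP hP pf pef; have de := pdom _ pe.
pose c := dual_norm E psi * N e.
have c0 : 0 <= c by rewrite mulr_ge0 ?(dual_norm_ge0 _ nsE)// (ns_norm_ge0 _ nsE).
apply: (halving_ge0 _ c c0) => k; elim: k f pf pef => [|k IH] f pf pef.
  have df := pdom _ pf.
  have : `|psi (M P f)| <= c.
    apply: le_trans (dual_norm_ub _ nsE _ dpsi _ (Mdom _ _ mP df)) _.
    rewrite ler_wpM2l ?(dual_norm_ge0 _ nsE)//.
    apply: le_trans (al_M_norm_le _ _ mP df) _; rewrite !al_normE//.
    have := ns_norm_ge0 _ nsE _ (pdom _ pef).
    by rewrite al_normE// (dualB _ nsE _ dI)// subr_ge0.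
  by rewrite expr0 mulr1 ler_norml => /andP[].
have df := pdom _ pf.
have d2f : ns_dom E (2 *: f) by exact: (ns_domZ _ nsE).
have [Q [mQ pQ nQ]] := al_hahn _ _ _ _ alE _ (ns_domB _ nsE _ _ d2f de).
have mQ' := measurableC mQ.
rewrite al_MB// in pQ; rewrite al_MB// in nQ.
rewrite al_MZ// in pQ; rewrite al_MZ// opprB in nQ.
have dQe := Mdom _ _ mQ de.
have fE := al_MC _ _ _ _ alE Q f mQ df; have eE := al_MC _ _ _ _ alE Q e mQ de.
pose f' := 2 *: f - M Q e.
have pf' : pos f'.
  have -> : f' = (2 *: M Q f - M Q e) + 2 *: M (~` Q) f.
    by rewrite /f' {1}fE scalerDr addrAC.
  by apply: pD => //; apply: pZ => //; exact: Mpos.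
have pef' : pos (e - f').
  have -> : e - f' = 2 *: M Q (e - f) + (M (~` Q) e - 2 *: M (~` Q) f).
    rewrite /f' {1}eE {1}fE al_MB// !scalerDr scalerN opprB opprD.
    rewrite [2 *: M Q e](_ : _ = M Q e + M Q e); last by rewrite scaler_nat.
    by rewrite [RHS]addrACA -!addrA; congr (_ + _); rewrite addrCA; congr (_ + _); rewrite addrCA.
  by apply: pD => //; apply: pZ => //; exact: Mpos.
have IHf := IH _ pf' pef'.
(* The first term on the right is nonnegative because P [&] Q lies in [P]. So a lower bound for [f']
   gives half that bound for [f]. *)
have : psi (M P (2 *: f)) = psi (M (P `&` Q) e) + psi (M P f').
  have -> : 2 *: f = M Q e + f' by rewrite /f' addrC subrK.
  rewrite al_MD// ?(al_MM _ _ _ _ alE)//; last exact: pdom.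
  by rewrite (dualD _ _ dpsi)//; apply: Mdom => //; [exact: measurableI|exact: pdom].
rewrite al_MZ// (dualZ _ nsE _ dpsi); last exact: Mdom.
have := hP _ (measurableI _ _ mP mQ) (@subIsetl _ _ _).
move: IHf; rewrite exprS; set u := c * _.
rewrite (_ : c * (2^-1 * 2^-1 ^+ k) = 2^-1 * u); last by rewrite /u; ring.
lra.
Qed.

(** The set comes from the Hahn decomposition of A |-> psi (M A e). [al_half_hahn] extends the sign
    to 0 <= f <= e, and a general [f] in the band of [e] lies below a multiple of [e] outside a set
    where its norm is small. The negative side is the same argument for [- psi]. *)
Lemma al_functional_hahn e B psi : pos e -> measurable B -> M B e = e ->
  (forall f eps, pos f -> M B f = f -> 0 < eps -> exists A r,
      [/\ measurable A, 0 < r, pos (r *: e - M (~` A) f) &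
          N (M A f) <= eps]) ->
  dual_dom E psi -> exists P, [/\ measurable P,
    forall f, pos f -> M B f = f -> 0 <= psi (M P f) &
    forall f, pos f -> M B f = f -> psi (M (~` P) f) <= 0].
Proof.
move=> pe mB Be supB dpsi; have de := pdom _ pe.
have key psi' P : dual_dom E psi' -> measurable P ->
    (forall A, measurable A -> A `<=` P -> 0 <= psi' (M A e)) ->
    forall f, pos f -> M B f = f -> 0 <= psi' (M P f).
  move=> dp mP hP f pf Bf; have df := pdom _ pf.
  pose c := dual_norm E psi'; have c0 : 0 <= c by exact: (dual_norm_ge0 _ nsE).
  suff : forall eps, 0 < eps -> - eps <= psi' (M P f).
    by move=> h; rewrite leNgt; apply/negP => lt0; have := h (- psi' (M P f) / 2); lra.
  move=> eps e0; have e1 : 0 < eps / (c + 1) by rewrite divr_gt0//; lra.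
  have [A [r [mA r0 pr nA]]] := supB _ _ pf Bf e1.
  have mA' := measurableC mA.
  have pMf : pos (M (~` A) f) by exact: Mpos.
  have pos1 : 0 <= psi' (M P (r^-1 *: M (~` A) f)).
    apply: (al_half_hahn _ e) => //; first by apply: pZ => //; rewrite invr_ge0 ltW.
    have -> : e - r^-1 *: M (~` A) f = r^-1 *: (r *: e - M (~` A) f).
      by rewrite scalerBr scalerA mulVf ?gt_eqF// scale1r.
    by apply: pZ => //; rewrite invr_ge0 ltW.
  rewrite al_MZ// in pos1; last exact: pdom.
  rewrite (dualZ _ nsE _ dp) in pos1; last by apply: Mdom => //; exact: pdom.
  rewrite pmulr_rge0 ?invr_gt0// in pos1.
  rewrite (al_MC _ _ _ _ alE A f mA df) al_MD//; [|exact: Mdom..].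
  rewrite (dualD _ _ dp); [|by apply: Mdom => //; exact: Mdom..].
  have : `|psi' (M P (M A f))| <= eps.
    apply: le_trans (dual_norm_ub _ nsE _ dp _ (Mdom _ _ mP (Mdom _ _ mA df))) _.
    apply: (@le_trans _ _ (c * (eps / (c + 1)))).
      rewrite ler_wpM2l//; apply: le_trans nA; apply: al_M_norm_le => //.
      exact: Mdom.
    rewrite mulrA ler_pdivrMr; last by lra.
    by rewrite mulrC ler_wpM2l ?lerDl// ltW.
  by rewrite ler_norml => /andP[]; lra.
have kD A A' : measurable A -> measurable A' -> A `&` A' = set0 ->
    psi (M (A `|` A') e) = psi (M A e) + psi (M A' e).
  by move=> *; exact: al_M_additive.
have [P [mP hP hN]] := al_Hahn (fun A => psi (M A e)) e (dual_norm E psi) kD de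
  (fun A mA => dual_norm_ub _ nsE _ dpsi _ (Mdom _ _ mA de)).
exists P; split => //; first exact: key.
move=> f pf Bf; have dnpsi : dual_dom E (- psi : ns_car (dual E)) by exact: (ns_domN _ nsE1).
have := key _ _ dnpsi (measurableC mP) _ f pf Bf.
rewrite dual_evalN oppr_ge0; apply => A mA AP.
by rewrite dual_evalN oppr_ge0; exact: hN.
Qed.

Lemma al_I_pos : dpos I.
Proof.
split => // f pf; rewrite -al_normE//; apply: (ns_norm_ge0 _ nsE); exact: pdom.
Qed.

Lemma dpos_le psi chi f : dpos (chi - psi) -> pos f -> psi f <= chi f.
Proof. by move=> [_ h] pf; have := h _ pf; rewrite dual_evalB subr_ge0. Qed.

(* Again by halving: [psi] is replaced by
   [2 psi M_A - I M_{A `&` P}], where [P] is the set on which [psi >= I/2]. *)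
Lemma al_domination (H : ns_car (dual (dual E))) e B A t :
  ddpos H -> pos e -> measurable B -> M B e = e ->
  (forall f eps, pos f -> M B f = f -> 0 < eps -> exists A r,
      [/\ measurable A, 0 < r, pos (r *: e - M (~` A) f) &
          N (M A f) <= eps]) ->
  measurable A -> A `<=` B -> 0 <= t ->
  (forall A', measurable A' -> A' `<=` A ->
    t * I (M A' e) <= H (comp_M I A')) ->
  forall psi, dpos psi -> t * psi (M A e) <= H (comp_M psi A).
Proof.
move=> [dH H0] pe mB Be supB mA AB t0 hA.
have de := pdom _ pe; have dMA := Mdom _ _ mA de.
have MB g : ns_dom E g -> M B (M A g) = M A g.
  by move=> dg; rewrite (al_MM _ _ _ _ alE)// setIC (setIidl AB).
(* [I] is an order unit: [psi] is at most its norm times [I] on the cone. Rescaling reduces to psi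
   <= I; the 1 added to the norm keeps the factor invertible. *)
suff key psi : dpos psi -> dpos (I - psi) ->
    0 <= H (comp_M psi A) - t * psi (M A e).
  move=> psi [dpsi p0]; pose c := dual_norm E psi + 1.
  have n0 : 0 <= dual_norm E psi by exact: (dual_norm_ge0 _ nsE).
  have c0 : 0 < c by rewrite /c; lra.
  have dcpsi : dual_dom E (c^-1 *: psi) by exact: (ns_domZ _ nsE1).
  have p1 : dpos (c^-1 *: psi).
    by split => // f pf; rewrite dual_evalZ mulr_ge0 ?p0// invr_ge0 ltW.
  have p2 : dpos (I - c^-1 *: psi).
    split; first exact: (ns_domB _ nsE1).
    move=> f pf; rewrite dual_evalB dual_evalZ subr_ge0 ler_pdivrMl//.
    apply: le_trans (ler_norm _) _.
    apply: le_trans (dual_norm_ub _ nsE _ dpsi _ (pdom _ pf)) _.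
    rewrite -al_normE// ler_wpM2r ?lerDl//; apply: (ns_norm_ge0 _ nsE); exact: pdom.
  have := key _ p1 p2; rewrite dual_evalZ.
  rewrite (_ : comp_M _ A = c^-1 *: comp_M psi A)//.
  rewrite (dualZ _ nsE1 _ dH); last exact: comp_M_dom.
  by rewrite mulrCA -mulrBr pmulr_rge0 ?invr_gt0// subr_ge0.
pose c := t * I e.
have c0 : 0 <= c by rewrite mulr_ge0// -al_normE// (ns_norm_ge0 _ nsE).
move=> p1 p2; apply: (halving_ge0 _ c c0) => k.
elim: k psi p1 p2 => [|k IH] psi p1 p2.
  rewrite expr0 mulr1.
  have h1 : 0 <= H (comp_M psi A) by apply: H0; exact: comp_M_pos.
  have pMe : pos (M A e) by exact: Mpos.
  have h2 : psi (M A e) <= I e.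
    apply: (@le_trans _ _ (I (M A e))); first exact: dpos_le.
    by rewrite -!al_normE//; exact: al_M_norm_le.
  have : t * psi (M A e) <= c by rewrite ler_wpM2l.
  lra.
have dpsi := p1.1.
have d2 : dual_dom E (2 *: psi - I).
  by apply: (ns_domB _ nsE1) => //=; exact: (ns_domZ _ nsE1).
have [P [mP hP hN]] := al_functional_hahn _ _ _ pe mB Be supB d2.
have mP' := measurableC mP.
have mAP : measurable (A `&` P) by exact: measurableI.
pose psi' : ns_car (dual E) := 2 *: comp_M psi A - comp_M I (A `&` P).
have dpA : dual_dom E (comp_M psi A) by exact: comp_M_dom.
have dIAP : dual_dom E (comp_M I (A `&` P)) by exact: comp_M_dom.
have d2pA : dual_dom E (2 *: comp_M psi A) by exact: (ns_domZ _ nsE1).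
have dpsi' : dual_dom E psi' by exact: (ns_domB _ nsE1).
have eP f : pos f -> [/\ psi (M A f) = psi (M P (M A f)) + psi (M (~` P) (M A f)),
    I (M A f) = I (M P (M A f)) + I (M (~` P) (M A f)) &
    M (A `&` P) f = M P (M A f)].
  move=> pf; have df := pdom _ pf; have dAf := Mdom _ _ mA df.
  have e1 := al_MC _ _ _ _ alE P _ mP dAf.
  split; last by rewrite (al_MM _ _ _ _ alE)// setIC.
  - by rewrite {1}e1 (dualD _ _ dpsi)//; exact: Mdom.
  - by rewrite {1}e1 (dualD _ _ dI)//; exact: Mdom.
have evals f : psi' f = 2 * psi (M A f) - I (M (A `&` P) f) by [].
have pp1 : dpos psi'.
  split => // f pf; rewrite evals; have [-> _ ->] := eP f pf.
  have pAf : pos (M A f) by exact: Mpos.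
  have := hP _ pAf (MB _ (pdom _ pf)); rewrite dual_evalB dual_evalZ.
  have : 0 <= psi (M (~` P) (M A f)) by apply: p1.2; exact: Mpos.
  lra.
have pp2 : dpos (I - psi').
  split; first exact: (ns_domB _ nsE1).
  move=> f pf; rewrite dual_evalB evals; have [-> eI ->] := eP f pf.
  have pAf : pos (M A f) by exact: Mpos.
  have := hN _ pAf (MB _ (pdom _ pf)); rewrite dual_evalB dual_evalZ.
  have : psi (M P (M A f)) <= I (M P (M A f)) by apply: dpos_le => //; exact: Mpos.
  have : I (M A f) <= I f by rewrite -!al_normE//; apply: al_M_norm_le => //; exact: pdom.
  lra.
have := IH _ pp1 pp2.
have -> : comp_M psi' A = 2 *: comp_M psi A - comp_M I (A `&` P).
  have eA : comp_M (comp_M psi A) A = comp_M psi A by rewrite comp_MM// setIid.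
  have eB : comp_M (comp_M I (A `&` P)) A = comp_M I (A `&` P).
    by rewrite comp_MM// setIAC setIid.
  by rewrite -[in RHS]eA -[in RHS]eB.
rewrite (dualB _ nsE1 _ dH)// (dualZ _ nsE1 _ dH)// evals.
have MMA : M A (M A e) = M A e by rewrite (al_MM _ _ _ _ alE)// setIid.
have MMP : M (A `&` P) (M A e) = M (A `&` P) e.
  by rewrite (al_MM _ _ _ _ alE)//; congr (M _ e); rewrite setIAC setIid.
rewrite MMA MMP.
(* The quantity for [psi'] is twice that for [psi] minus the one for [I] on A [&] P, which is
   nonnegative by [hA]. Hence the error is halved. *)
have := hA _ mAP (@subIsetl _ _ _).
rewrite exprS; set u := c * _ ^+ k.
rewrite (_ : c * (2^-1 * 2^-1 ^+ k) = 2^-1 * u); last by rewrite /u; ring.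
set a1 := H _; set a2 := H _; set a3 := psi _; set a4 := I _ => a42.
rewrite mulrBr mulrCA; lra.
Qed.

(** The bound of [H] by [j e] makes A |-> H (comp_M I A) dominated by the norm of [M A e], so that
    it has a Hahn decomposition after subtracting t I (M A e). *)
Lemma al_exists_below (H : ns_car (dual (dual E))) e :
  ddpos H -> pos e -> ddpos (j e - H) -> 0 < H I ->
  exists x, [/\ pos x, 0 < I x & ddpos (H - j x)].
Proof.
move=> [dH H0] pe [_ jeH] HI; have de := pdom _ pe.
have [B [mB Be supB]] := al_support _ _ _ _ alE e pe.
have Ie0 : 0 <= I e by apply: al_I_pos.2.
(* This [t] makes t I e less than half of H I. The negative set then carries less than half of H I,
   whence I (M P e) > H I / 2 on the positive set [P]. The 1 guards against I e = 0. *)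
pose t := H I / (2 * (I e + 1)).
have t0 : 0 < t by rewrite divr_gt0//; lra.
have tIe : t * I e < H I / 2.
  rewrite /t invfM mulrA mulrAC -mulrA gtr_pMr; last by rewrite divr_gt0.
  by rewrite ltr_pdivrMr; lra.
have Hle A : measurable A -> H (comp_M I A) <= I (M A e).
  move=> mA; have := jeH _ (comp_M_pos _ _ al_I_pos mA).
  by rewrite dual_evalB subr_ge0 bicanonE//; exact: comp_M_dom.
have Hge A : measurable A -> 0 <= H (comp_M I A).
  by move=> mA; apply: H0; exact: comp_M_pos al_I_pos mA.
have pMe A : measurable A -> pos (M A e) by move=> mA; exact: Mpos.
have [P [mP hP hN]] : exists P, [/\ measurable P,
    forall A, measurable A -> A `<=` P -> 0 <= H (comp_M I A) - t * I (M A e) &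
    forall A, measurable A -> A `<=` ~` P -> H (comp_M I A) - t * I (M A e) <= 0].
  apply: (al_Hahn _ e (1 + t)) => // [A A' mA mA' AA'|A mA].
    rewrite al_M_additive//.
    have -> : comp_M I (A `|` A') = comp_M I A + comp_M I A'.
      apply/funext => f; rewrite dual_evalD /comp_M.
      have [df|df] := pselect (ns_dom E f); first by rewrite al_M_additive.
      by rewrite !(al_M_out _ _ _ _ alE)// (dual0 _ nsE _ dI) addr0.
    by rewrite (dualD _ _ dH); [ring|exact: comp_M_dom..].
  rewrite al_normE; last exact: pMe.
  have a1 := Hle _ mA; have a2 := Hge _ mA.
  have a3 : 0 <= I (M A e) by apply: al_I_pos.2; exact: pMe.
  have a4 : 0 <= t * I (M A e) by rewrite mulr_ge0// ltW.
  by rewrite ler_norml mulrDl mul1r; lra.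
have mP' := measurableC mP.
have PB : measurable (P `&` B) by exact: measurableI.
exists (t *: M (P `&` B) e); split.
- by apply: pZ; [exact: ltW|exact: pMe].
- rewrite (dualZ _ nsE _ dI); last exact: Mdom.
  rewrite pmulr_rgt0// -(al_MM _ _ _ _ alE)// Be.
  have h1 : H I = H (comp_M I P) + H (comp_M I (~` P)).
    by rewrite {1}(comp_MC _ _ dI mP) (dualD _ _ dH)//; exact: comp_M_dom.
  have h2 := hN _ mP' (@subset_refl _ _).
  have h3 := Hle _ mP.
  have h4 : t * I (M (~` P) e) <= t * I e.
    rewrite ler_wpM2l ?(ltW t0)// -!al_normE//; last exact: pMe.
    exact: al_M_norm_le.
  lra.
- split; first by apply: (ns_domB _ nsE2) => //; apply: bicanon_dom => //;
    apply: (ns_domZ _ nsE); exact: Mdom.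
  move=> psi ppsi; have dpsi := ppsi.1.
  rewrite dual_evalB bicanonE// subr_ge0.
  rewrite (dualZ _ nsE _ dpsi); last exact: Mdom.
  (* The Hahn set only compares the functionals [comp_M I A]; [al_domination] extends this to [psi],
     on the part of [P] inside the support of [e]. *)
  apply: (@le_trans _ _ (H (comp_M psi (P `&` B)))).
    apply: (al_domination _ _ B) => //; first exact: ltW.
    move=> A' mA' A'P; rewrite -subr_ge0; apply: hP => //.
    by move=> s /A'P[].
  have PB' := measurableC PB.
  rewrite [in leRHS](comp_MC _ _ dpsi PB) (dualD _ _ dH); [|exact: comp_M_dom..].
  by rewrite lerDl; apply: H0; exact: comp_M_pos.
Qed.

(** * Maximal minorants and singular functionals *)

Lemma bicanon_pos x : pos x -> ddpos (j x).
Proof.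
move=> px; split; first exact: (bicanon_dom _ nsE _ (pdom _ px)).
by move=> psi [dpsi p0]; rewrite bicanonE// p0.
Qed.

(* Greedy choice: each term of the sequence realizes at least half of the
   possible increase of [I]; its limit exists because [I] is the norm on [pos]. *)
Lemma al_maximal (F : ns_car (dual (dual E))) : ddpos F ->
  exists x, [/\ pos x, ddpos (F - j x) &
    forall y, pos y -> ddpos (F - j x - j y) -> I y <= 0].
Proof.
move=> [dF F0].
pose ok x := pos x /\ ddpos (F - j x).
have okI x : ok x -> I x <= F I.
  move=> [px [_ h]]; have := h _ al_I_pos.
  by rewrite dual_evalB bicanonE// subr_ge0.
pose m x := sup [set I y | y in [set y | ok y /\ pos (y - x)]].
have m_ub x y : ok y -> pos (y - x) -> I y <= m x.
  move=> oky pyx; rewrite /m; apply: ub_le_sup; last by exists y.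
  by exists (F I) => _ [z [okz _] <-]; exact: okI.
(* The last clause says that I y - I x is at least half of m x - I x. *)
have /choice[nx hnx] : forall x, exists y, ok x ->
    [/\ ok y, pos (y - x) & m x <= 2 * I y - I x].
  move=> x; have [okx|] := pselect (ok x); last by exists 0.
  have okxx : pos (x - x) by rewrite subrr; exact: (pos0 _ _ rE).
  have [le|lt] := leP (m x) (I x).
    by exists x => _; split => //; lra.
  have hs : has_sup [set I y | y in [set y | ok y /\ pos (y - x)]].
    split; first by exists (I x), x.
    by exists (F I) => _ [z [okz _] <-]; exact: okI.
  have e0 : 0 < (m x - I x) / 2 by rewrite divr_gt0//; lra.
  have [_ [y [oky pyx] <-] hy] := sup_adherent e0 hs.
  by exists y => _; split => //; move: hy; rewrite -/(m x); lra.
pose f n := iter n nx 0.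
have okf n : ok (f n).
  elim: n => [|n IH]; last by have [] := hnx _ IH.
  split; first exact: (pos0 _ _ rE).
  split => [|psi ppsi].
    by apply: (ns_domB _ nsE2) => //; apply: bicanon_dom => //; exact: (ns_dom0 _ nsE).
  have dpsi := ppsi.1.
  by rewrite dual_evalB bicanonE// (dual0 _ nsE _ dpsi) subr0 F0.
have inc n : pos (f n.+1 - f n) by have [] := hnx _ (okf n).
have df n : ns_dom E (f n) by exact: pdom (okf n).1.
have Nf n : N (f n) <= F I by rewrite al_normE ?okI//; exact: (okf n).1.
have [g [dg hg]] := al_complete _ _ _ _ alE f (F I) (fun n => (okf n).1) inc Nf.
have inc_le n k : pos (f (n + k)%N - f n).
  elim: k => [|k IH]; first by rewrite addn0 subrr; exact: (pos0 _ _ rE).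
  by rewrite addnS -(subrKA (f (n + k)%N)); apply: pD.
(* Positivity passes to the limit through [al_posP]: N (g - f n) exceeds I (g - f n) by at most 2 N
   (g - f l), which is arbitrarily small. *)
have gf n : pos (g - f n).
  have dgf k : ns_dom E (g - f k) by exact: (ns_domB _ nsE).
  apply: (al_posP _ _ _ _ alE) => //; apply/ler_addgt0Pr => eps e0.
  have e2 : 0 < eps / 2 by rewrite divr_gt0.
  have [k hk] := hg _ e2; have := hk _ (leq_addl n k).
  set l := (n + k)%N => hl.
  have : N (g - f n) <= N (g - f l) + N (f l - f n).
    rewrite -(subrKA (f l)); apply: (ns_normD _ nsE) => //.
    exact: (ns_domB _ nsE).
  rewrite (al_normE _ (inc_le n k)) !(dualB _ nsE _ dI)//.
  have : I (g - f l) <= N (g - f l) by exact: (al_I_le _ _ _ _ alE).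
  have : - N (g - f l) <= I (g - f l).
    rewrite -[I _]opprK -(dualN _ nsE _ dI)// lerN2 -(ns_normN _ nsE)//.
    by apply: (al_I_le _ _ _ _ alE); exact: (ns_domN _ nsE).
  by rewrite !(dualB _ nsE _ dI)//; lra.
have pg : pos g by rewrite -[g](subrK (f 0%N)); apply: pD => //; exact: (okf 0%N).1.
have okg : ok g.
  split => //; split.
    by apply: (ns_domB _ nsE2) => //; apply: bicanon_dom.
  move=> psi ppsi; have dpsi := ppsi.1; rewrite dual_evalB bicanonE// subr_ge0.
  pose c := dual_norm E psi + 1.
  have n0 : 0 <= dual_norm E psi by exact: (dual_norm_ge0 _ nsE).
  have c0 : 0 < c by rewrite /c; lra.
  apply/ler_addgt0Pr => eps e0.
  have e2 : 0 < eps / c by rewrite divr_gt0.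
  have [k hk] := hg _ e2; have {}hk := hk _ (leqnn k).
  have dgk : ns_dom E (g - f k) by exact: (ns_domB _ nsE).
  have : psi (g - f k) <= eps.
    apply: le_trans (ler_norm _) _.
    apply: le_trans (dual_norm_ub _ nsE _ dpsi _ dgk) _.
    apply: (@le_trans _ _ (c * (eps / c))).
      rewrite ler_pM// ?(ns_norm_ge0 _ nsE)//.
      by rewrite /c lerDl.
    by rewrite mulrC divfK// gt_eqF.
  have := (okf k).2.2 _ ppsi; rewrite dual_evalB bicanonE// subr_ge0.
  by rewrite (dualB _ nsE _ dpsi)//; lra.
exists g; split => //; first exact: okg.2.
move=> y py pFgy; have dy := pdom _ py.
apply/ler_addgt0Pr => eps e0; rewrite add0r.
have [k hk] := hg _ e0; have {}hk := hk _ (leqnn k).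
have okgy : ok (g + y).
  by split; [exact: pD|rewrite bicanonD// opprD addrA].
have pgyk : pos (g + y - f k) by rewrite addrAC; exact: pD.
(* As g + y competes in the choice after [f k], one gets I g + I y <= 2 I (f k.+1) - I (f k) <= 2 I
   g - I (f k), so I y <= I (g - f k). *)
have h1 := m_ub _ _ okgy pgyk; rewrite (dualD _ _ dI)// in h1.
have [_ _ h2] := hnx _ (okf k).
have h3 : I (f k.+1) <= I g.
  by have := al_I_pos.2 _ (gf k.+1); rewrite (dualB _ nsE _ dI)// subr_ge0.
have h4 : I (g - f k) <= eps.
  apply: le_trans hk; apply: (al_I_le _ _ _ _ alE); exact: (ns_domB _ nsE).
rewrite (dualB _ nsE _ dI)// in h4.
move: h2; rewrite -/(f k.+1); lra.
Qed.

(** The infimum over chi of s chi + (I - chi) e is the Riesz-Kantorovich value at [I] of the infimum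
    of [s] and [j e]. The condition thus says that [s] is disjoint from every [j e]. *)
Definition al_singular (s : ns_car (dual (dual E))) : Prop :=
  ddpos s /\ forall e eps, pos e -> 0 < eps ->
    exists chi, [/\ dpos chi, dpos (I - chi) & s chi + (I - chi) e <= eps].

Lemma al_singular0 : al_singular 0.
Proof.
split; first exact: (pos0 _ _ rE2).
move=> e eps pe e0; exists I; rewrite subrr; split.
- exact: al_I_pos.
- exact: (pos0 _ _ rE1).
- by rewrite (_ : _ + _ = 0 + 0 :> R)// addr0 ltW.
Qed.

Lemma al_singularZ a s : 0 <= a -> al_singular s -> al_singular (a *: s).
Proof.
move=> a0 [ps hs]; split; first exact: (posZ _ _ rE2).
move=> e eps pe e0; have a1 : 0 < a + 1 by lra.
have e1 : 0 < eps / (a + 1) by rewrite divr_gt0.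
have [chi [pc pIc hc]] := hs _ _ pe e1.
exists chi; split => //; rewrite dual_evalZ.
have := ps.2 _ pc; have := pIc.2 _ pe; move: hc.
rewrite ler_pdivlMr//; set u := s chi; set v := (I - chi) e => h v0 u0.
by nra.
Qed.

(** One functional must serve both summands. Decomposing chi1 <= chi2 + (I - chi2) gives [y] below
    [chi1] and [chi2] with I - y <= (I - chi1) + (I - chi2). *)
Lemma al_singularD s1 s2 : al_singular s1 -> al_singular s2 ->
  al_singular (s1 + s2).
Proof.
move=> [p1 h1] [p2 h2]; split; first exact: (posD _ _ rE2).
move=> e eps pe e0; have e1 : 0 < eps / 2 by rewrite divr_gt0.
have [chi1 [pc1 pIc1 hc1]] := h1 _ _ pe e1.
have [chi2 [pc2 pIc2 hc2]] := h2 _ _ pe e1.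
have [|y [py p1y p2y pIy]] := pos_decomp _ _ rE1 _ _ _ pc1 pc2 pIc2.
  by rewrite [chi2 + _]addrC subrK.
exists y; split => //.
  by rewrite -(subrKA chi1); exact: (posD _ _ rE1).
have q1 := dpos_le _ _ _ pIy pe.
have q2 := p1.2 _ p1y; have q3 := p2.2 _ p2y.
rewrite (dualB _ nsE1 _ p1.1) in q2; [|exact: pc1.1|exact: py.1].
rewrite (dualB _ nsE1 _ p2.1) in q3; [|exact: pc2.1|exact: py.1].
rewrite !dual_evalB in q1 hc1 hc2 *; rewrite dual_evalD.
lra.
Qed.

Lemma al_positive_decomp (F : ns_car (dual (dual E))) : ddpos F ->
  exists x s, [/\ pos x, al_singular s & F = j x + s].
Proof.
move=> pF; have [x [px pG hx]] := al_maximal _ pF.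
exists x, (F - j x); split => //; last by rewrite addrC subrK.
split => // e eps pe e0; set G := F - j x in pG hx *.
have pje := bicanon_pos _ pe.
have djeG : dual_dom (dual E) (j e - G).
  by apply: (ns_domB _ nsE2); [exact: pje.1|exact: pG.1].
have [C _ hC] := dual_positive_part _ _ rE1.
have [K [pK pKG hK _]] := hC _ djeG.
(* [H] is the infimum of [G] and [j e], since [K] is the positive part of j e - G. *)
pose H : ns_car (dual (dual E)) := j e - K.
have pH : ddpos H.
  apply: (dual_positive_part_min _ _ rE1 _ _ _ djeG pK.1 hK) => //.
  by rewrite subKr.
have pjeH : ddpos (j e - H) by rewrite subKr.
have pGH : ddpos (G - H) by rewrite /H opprB addrCA -opprB.
have HI : H I <= 0.
  rewrite leNgt; apply/negP => HI.
  have [y [py Iy pHy]] := al_exists_below _ _ pH pe pjeH HI.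
  have : I y <= 0.
    apply: hx => //; rewrite -(subrKA H); exact: (posD _ _ rE2).
  by rewrite leNgt Iy.
(* H I <= 0 means K I >= I e. So a [chi] with (j e - G) chi within [eps] of K I makes G chi + (I -
   chi) e at most [eps]. *)
have [chi [pc pIc hc]] := hK _ _ al_I_pos e0.
exists chi; split => //.
move: HI hc; rewrite /H !dual_evalB !bicanonE//; last exact: pc.1.
lra.
Qed.

(** * The singular complement and norm additivity *)

Definition al_complement : set (ns_car (dual (dual E))) :=
  [set s | exists s1 s2, [/\ al_singular s1, al_singular s2 & s = s1 - s2]].

Lemma al_complement_subspace : is_subspace (dual (dual E)) al_complement.
Proof.
split.
  move=> _ [s1 [s2 [h1 h2 ->]]].
  by apply: (ns_domB _ nsE2); [exact: h1.1.1|exact: h2.1.1].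
split; first by exists 0, 0; rewrite subr0; split => //; exact: al_singular0.
move=> a _ _ [s1 [s2 [h1 h2 ->]]] [t1 [t2 [k1 k2 ->]]].
have [a0|a0] := leP 0 a.
  exists (a *: s1 + t1), (a *: s2 + t2); split.
  - by apply: al_singularD => //; exact: al_singularZ.
  - by apply: al_singularD => //; exact: al_singularZ.
  - by rewrite scalerBr opprD addrACA.
have na : 0 <= - a by lra.
exists ((- a) *: s2 + t1), ((- a) *: s1 + t2); split.
- by apply: al_singularD => //; exact: al_singularZ.
- by apply: al_singularD => //; exact: al_singularZ.
- by rewrite scalerBr !scaleNr opprD opprK [RHS]addrACA [X in _ = X + _]addrC.
Qed.

(** The norm is [I] on the cone and is additive over the Hahn set of [f]; hence the dual unit ball
    is the order interval from [- I] to [I]. *)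
Lemma al_ball psi : dual_dom E psi ->
  (dual_norm E psi <= 1 <-> dpos (I - psi) /\ dpos (I + psi)).
Proof.
move=> dpsi; split => [n1|[p1 p2]].
  have h f : pos f -> `|psi f| <= I f.
    move=> pf; rewrite -al_normE//.
    apply: le_trans (dual_norm_ub _ nsE _ dpsi _ (pdom _ pf)) _.
    by rewrite -[leRHS]mul1r ler_wpM2r ?(ns_norm_ge0 _ nsE)//; exact: pdom.
  split; split; [exact: (ns_domB _ nsE1)| |exact: (ns_domD _ nsE1)|];
    move=> f /h; rewrite ler_norml ?dual_evalB ?dual_evalD => /andP[]; lra.
apply: dual_norm_le => // f df f1; apply: le_trans f1.
have [A [mA pA nA]] := al_hahn _ _ _ _ alE f df; have mA' := measurableC mA.
rewrite (al_M_norm _ _ _ _ alE A)// -[N (M (~` A) f)](ns_normN _ nsE); last exact: Mdom.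
rewrite !al_normE// {1}(al_MC _ _ _ _ alE A f mA df) (dualD _ _ dpsi); [|exact: Mdom..].
have := p1.2 _ pA; have := p2.2 _ pA; have := p1.2 _ nA; have := p2.2 _ nA.
rewrite !dual_evalB !dual_evalD (dualN _ nsE _ dpsi); last exact: Mdom.
by rewrite ler_norml; lra.
Qed.

(** [psi'] plays the role of the product of [psi] and [chi]. It arises by decomposing I + psi <= 2
    chi + 2 (I - chi) and shifting the first piece back by [chi]. *)
Lemma al_split psi chi : dpos (I - psi) -> dpos (I + psi) -> dpos chi ->
  dpos (I - chi) -> dual_dom E psi ->
  exists psi', [/\ dual_dom E psi', dpos (chi - psi') /\ dpos (chi + psi') &
    dpos (I - chi - (psi - psi')) /\ dpos (I - chi + (psi - psi'))].
Proof.
move=> p1 p2 pc pIc dpsi.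
have p2c : dpos (chi + chi) by exact: (posD _ _ rE1).
have p2Ic : dpos ((I - chi) + (I - chi)) by exact: (posD _ _ rE1).
have [|y [py pxy pay pby]] := pos_decomp _ _ rE1 _ _ _ p2 p2c p2Ic.
  rewrite (_ : _ - _ = I - psi)//; apply/funext => f.
  by rewrite !(dual_evalB, dual_evalD); ring.
exists (y - chi); split.
- by apply: (ns_domB _ nsE1); [exact: py.1|exact: pc.1].
- split; first by rewrite opprB addrA.
  by rewrite addrC subrK.
- split.
  + rewrite (_ : _ - _ = I - chi + (I - chi) - (I + psi - y))//.
    by apply/funext => f; rewrite !(dual_evalB, dual_evalD); ring.
  + rewrite (_ : _ + _ = I + psi - y)//.
    by apply/funext => f; rewrite !(dual_evalB, dual_evalD); ring.
Qed.

(* Glue a functional norming [f] on [chi], where [s] is small, to one norming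
   [s] on [I - chi], where [f] is small. *)
Lemma al_complement_norm f s : ns_dom E f -> al_complement s ->
  N f + dual_norm (dual E) s <= dual_norm (dual E) (j f + s).
Proof.
move=> df Cs; have [Cdom _] := al_complement_subspace; have ds := Cdom _ Cs.
case: Cs => s1 [s2 [h1 h2 es]].
have djf : dual_dom (dual E) (j f) by exact: (bicanon_dom _ nsE).
have djfs : dual_dom (dual E) (j f + s) by exact: (ns_domD _ nsE2).
have [A [mA pA nA]] := al_hahn _ _ _ _ alE f df; have mA' := measurableC mA.
set a := M A f in pA; set b := - M (~` A) f in nA.
have da := pdom _ pA; have db := pdom _ nA.
have fE : f = a - b by rewrite opprK; exact: (al_MC _ _ _ _ alE).
have Nf : N f = I a + I b.
  by rewrite (al_M_norm _ _ _ _ alE A)// -[N (M (~` A) f)](ns_normN _ nsE) ?al_normE//; exact: Mdom.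
(* [psi2] is the sign of [f]. *)
pose psi2 : ns_car (dual E) := comp_M I A - comp_M I (~` A).
have pIA := comp_M_pos _ _ al_I_pos mA; have pIA' := comp_M_pos _ _ al_I_pos mA'.
have dpsi2 : dual_dom E psi2.
  by apply: (ns_domB _ nsE1); [exact: pIA.1|exact: pIA'.1].
have psi2f : psi2 f = N f.
  rewrite Nf /psi2 dual_evalB /comp_M -/a -[M (~` A) f]opprK -/b.
  by rewrite (dualN _ nsE _ dI)//; lra.
have IE := comp_MC _ _ dI mA.
have p2a : dpos (I - psi2).
  rewrite (_ : _ - _ = comp_M I (~` A) + comp_M I (~` A)); first exact: (posD _ _ rE1).
  by apply/funext => g; rewrite {1}IE /psi2 !(dual_evalB, dual_evalD); ring.
have p2b : dpos (I + psi2).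
  rewrite (_ : _ + _ = comp_M I A + comp_M I A); first exact: (posD _ _ rE1).
  by apply/funext => g; rewrite {1}IE /psi2 !(dual_evalB, dual_evalD); ring.
apply/ler_addgt0Pr => eps e0.
(* One third is lost in norming [s]; the two terms of [hc], together at most a third, are each spent
   twice, for [psi1'] and for [psi2']. *)
have e3 : 0 < eps / 3 by rewrite divr_gt0.
have [psi1 [dpsi1 n1 hs1]] := dual_norm_adherent _ nsE1 _ ds _ e3.
have [p1a p1b] := (al_ball _ dpsi1).1 n1.
have [_ h12] := al_singularD _ _ h1 h2.
have [chi [pc pIc hc]] := h12 _ _ (pD _ _ pA nA) e3.
have [psi1' [dpsi1' [q1 q2] [q3 q4]]] := al_split _ _ p1a p1b pc pIc dpsi1.
have [psi2' [dpsi2' [r1 r2] [r3 r4]]] := al_split _ _ p2a p2b pc pIc dpsi2.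
pose psi : ns_car (dual E) := psi2' + (psi1 - psi1').
have dpsi11 : dual_dom E (psi1 - psi1') by exact: (ns_domB _ nsE1).
have dpsi : dual_dom E psi by exact: (ns_domD _ nsE1).
have npsi : dual_norm E psi <= 1.
  apply/(al_ball _ dpsi); split.
    rewrite (_ : _ - _ = (chi - psi2') + (I - chi - (psi1 - psi1'))).
      exact: (posD _ _ rE1).
    by apply/funext => g; rewrite /psi !(dual_evalB, dual_evalD); ring.
  rewrite (_ : _ + _ = (chi + psi2') + (I - chi + (psi1 - psi1'))).
    exact: (posD _ _ rE1).
  by apply/funext => g; rewrite /psi !(dual_evalB, dual_evalD); ring.
have := dual_norm_ub1 _ nsE1 _ djfs _ dpsi npsi.
move=> /(le_trans (ler_norm _)); rewrite dual_evalD bicanonE//.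
have sev phi : s phi = s1 phi - s2 phi by rewrite es.
have d1 := h1.1.1; have d2 := h2.1.1; have dc := pc.1.
have sP (t : ns_car (dual (dual E))) phi : ddpos t -> dual_dom E phi -> dpos (chi - phi) -> dpos (chi + phi) ->
    `|t phi| <= t chi.
  move=> pt dphi pp pm; have := pt.2 _ pp; have := pt.2 _ pm.
  rewrite (dualB _ nsE1 _ pt.1)// (dualD _ _ pt.1)//.
  by rewrite ler_norml; lra.
have := sP _ _ h1.1 dpsi1' q1 q2; have := sP _ _ h2.1 dpsi1' q1 q2.
have := sP _ _ h1.1 dpsi2' r1 r2; have := sP _ _ h2.1 dpsi2' r1 r2.
rewrite !ler_norml => /andP[? ?] /andP[? ?] /andP[? ?] /andP[? ?].
rewrite /psi (dualD _ _ ds)// (dualB _ nsE1 _ ds)//.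
rewrite dual_evalD in hc; rewrite (dualD _ _ (pIc.1)) in hc => //.
have ev1 := q3.2 _ pA; have ev2 := q4.2 _ pA.
have ev3 := q3.2 _ nA; have ev4 := q4.2 _ nA.
have ev5 := r3.2 _ pA; have ev6 := r4.2 _ pA.
have ev7 := r3.2 _ nA; have ev8 := r4.2 _ nA.
have e1 : (psi2' + (psi1 - psi1')) f = psi2 f - (psi2 - psi2') a + (psi2 - psi2') b
    + (psi1 - psi1') a - (psi1 - psi1') b.
  rewrite !(dual_evalB, dual_evalD) fE.
  rewrite (dualB _ nsE _ dpsi1)// (dualB _ nsE _ dpsi1')//.
  by rewrite (dualB _ nsE _ dpsi2)// (dualB _ nsE _ dpsi2')//; ring.
rewrite e1 psi2f.
rewrite !(dual_evalB, dual_evalD) in hc ev1 ev2 ev3 ev4 ev5 ev6 ev7 ev8 *.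
rewrite !sev in hs1 *; lra.
Qed.

Lemma al_L_complement : L_complement E al_complement.
Proof.
split; [exact: al_complement_subspace| |exact: al_complement_norm].
move=> F dF; have [C _ hC] := dual_positive_part _ _ rE1.
have [K [pK pKF _ _]] := hC _ dF.
have [x1 [s1 [px1 hs1 e1]]] := al_positive_decomp _ pK.
have [x2 [s2 [px2 hs2 e2]]] := al_positive_decomp _ pKF.
have dx1 := pdom _ px1; have dx2 := pdom _ px2.
exists (x1 - x2), (s1 - s2); split.
- exact: (ns_domB _ nsE).
- by exists s1, s2.
- by rewrite bicanonB// -[F](subKr K) e2 e1 opprD addrACA.
Qed.
End ALSpace.

(** * The dual of an L_1-predual *)

(** Pointwise limits on [E]. Through the isometry with L_1(mu), completeness is taken from the dual
    of [X] and not from the measure space. *)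
Lemma dual_complete {R : realType} (E : nspace R) (f : nat -> ns_car (dual E)) :
  is_nspace E -> (forall n, dual_dom E (f n)) ->
  (forall eps, 0 < eps -> exists n0, forall n, (n0 <= n)%N ->
    dual_norm E (f n - f n0) <= eps) ->
  exists2 g, dual_dom E g & forall eps, 0 < eps -> exists n0, forall n,
    (n0 <= n)%N -> dual_norm E (g - f n) <= eps.
Proof.
move=> nsE df cf; have nsE1 := dual_is_nspace _ nsE.
have dist n m x : ns_dom E x ->
    `|f n x - f m x| <= dual_norm E (f n - f m) * ns_norm E x.
  move=> dx; rewrite (_ : f n x - f m x = (f n - f m) x)//.
  exact: (dual_norm_ub _ nsE _ (ns_domB _ nsE1 _ _ (df n) (df m)) _ dx).
have cvgf x : ns_dom E x -> cvg (f n x @[n --> \oo]).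
  move=> dx; apply/cauchy_cvgP; apply: cauchy_exP => eps e0.
  have N1 : 0 < ns_norm E x + 1 by rewrite ltr_wpDl// (ns_norm_ge0 _ nsE).
  have e1 : 0 < eps / 2 / (ns_norm E x + 1) by rewrite !divr_gt0.
  have [n0 h] := cf _ e1; exists (f n0 x).
  exists n0 => // n /= nn.
  rewrite /ball/= distrC; apply: le_lt_trans (dist _ _ _ dx) _.
  apply: (@le_lt_trans _ _ (eps / 2 / (ns_norm E x + 1) * (ns_norm E x + 1))).
    apply: ler_pM; [|exact: (ns_norm_ge0 _ nsE)|exact: h|by rewrite lerDl].
    exact: (dual_norm_ge0 _ nsE _ (ns_domB _ nsE1 _ _ (df n) (df n0))).
  by rewrite divfK ?gt_eqF// ltr_pdivrMr//; lra.
pose g : ns_car (dual E) :=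
  fun x => if `[< ns_dom E x >] then lim (f n x @[n --> \oo]) else 0.
have gE x : ns_dom E x -> f n x @[n --> \oo] --> g x.
  by move=> dx; rewrite /g asboolT //; exact: (cvgf _ dx).
(* The Cauchy condition compares with index [n0] only, so passing through [f n0] doubles the
   error. *)
have close n0 eps : (forall n, (n0 <= n)%N -> dual_norm E (f n - f n0) <= eps) ->
    forall n x, (n0 <= n)%N -> ns_dom E x ->
    `|g x - f n x| <= 2 * eps * ns_norm E x.
  move=> h n x n0n dx.
  have : (fun m => `|f m x - f n x|) @ \oo --> `|g x - f n x|.
    by apply: cvg_norm; apply: cvgB; [exact: gE|exact: cvg_cst].
  move/cvgr_to_le; apply; exists n0 => // m /= mm.
  have := dist m n0 x dx; have := dist n n0 x dx.
  have N0 := ns_norm_ge0 _ nsE _ dx.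
  have := ler_wpM2r N0 (h _ n0n); have := ler_wpM2r N0 (h _ mm).
  have := ler_distD (f n0 x) (f m x) (f n x); rewrite (distrC (f n0 x)).
  set u := _ * ns_norm E x; set v := _ * ns_norm E x; set w := eps * ns_norm E x.
  rewrite (_ : 2 * eps * ns_norm E x = 2 * w); last by rewrite /w; ring.
  lra.
have dg : dual_dom E g.
  have [n0 h] := cf 1 ltr01.
  apply: (dual_domI _ _ (dual_norm E (f n0) + 2 * 1)) => [x dx|a x y dx dy|x dx].
  - by rewrite /g asboolF.
  - have dxy : ns_dom E (a *: x + y) by exact: (ns_domP _ nsE).
    have h1 : (fun n => f n (a *: x + y)) @ \oo --> a * g x + g y.
      rewrite (_ : (fun n => _) = fun n => a * f n x + f n y); last first.
        by apply/funext => n; rewrite (dual_lin _ _ (df n)).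
      by apply: cvgD; [apply: cvgM; [exact: cvg_cst|exact: gE]|exact: gE].
    exact: cvg_unique (gE _ dxy) h1.
  - have := close _ _ h _ _ (leqnn _) dx.
    have := dual_norm_ub _ nsE _ (df n0) _ dx.
    have := ler_normD (g x - f n0 x) (f n0 x); rewrite subrK mulrDl; lra.
exists g => // eps e0; have e2 : 0 < eps / 2 by rewrite divr_gt0.
have [n0 h] := cf _ e2; exists n0 => n n0n.
apply: dual_norm_le => // x dx x1; rewrite (_ : _ x = g x - f n x)//.
apply: le_trans (close _ _ h _ _ n0n dx) _.
rewrite (_ : 2 * (eps / 2) = eps); last by field.
by rewrite -[leRHS]mulr1 ler_wpM2l// ltW.
Qed.

(** * Integrals of real-valued functions up to almost everywhere equality *)

Section RealIntegral.
Context {d} {T : measurableType d} {R : realType} (mu : {measure set T -> \bar R}).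
Implicit Types (f g h : T -> R).
Local Notation integ h := (mu.-integrable setT (EFin \o h)).

Lemma integ_measurable h : integ h -> measurable_fun setT h.
Proof. by move=> /measurable_int /measurable_EFinP. Qed.

Lemma integ_le g h : measurable_fun setT g -> (forall t, `|g t| <= `|h t|) ->
  integ h -> integ g.
Proof.
move=> mg gh; apply: le_integrable => //; first exact/measurable_EFinP.
by move=> t _; rewrite /= lee_fin.
Qed.

Lemma integ_lin (a : R) f g : integ f -> integ g -> integ (fun t => a * f t + g t).
Proof.
move=> hf hg; have := integrableD measurableT (integrableZl measurableT a hf) hg.
by apply: eq_integrable.
Qed.

Lemma integ_abs h : integ h -> integ (fun t => `|h t|).
Proof.
move=> hh; apply: (integ_le _ h) => // [|t]; last by rewrite normr_id.
by apply: measurableT_comp => //; exact: integ_measurable.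
Qed.

Lemma Rintegral_lin (a : R) f g : integ f -> integ g ->
  Rintegral mu setT (fun t => a * f t + g t) =
  a * Rintegral mu setT f + Rintegral mu setT g.
Proof.
move=> hf hg; rewrite RintegralD//; last exact: (integrableZl measurableT a hf).
by rewrite RintegralZl.
Qed.

Lemma Rintegral_ae f g : integ f -> integ g -> {ae mu, forall t, f t = g t} ->
  Rintegral mu setT f = Rintegral mu setT g.
Proof.
move=> hf hg fg; rewrite /Rintegral; congr fine; apply: ae_eq_integral => //.
- exact: measurable_int hf.
- exact: measurable_int hg.
- by move: fg; apply: filterS => t -> _.
Qed.

Lemma Rintegral_abs_eq0 h : integ h -> Rintegral mu setT (fun t => `|h t|) <= 0 ->
  {ae mu, forall t, h t = 0}.
Proof.
move=> hh h0; have mh := measurable_int _ hh.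
have : (\int[mu]_t `|(EFin \o h) t| = 0)%E.
  have fi : (\int[mu]_t `|(EFin \o h) t|)%E \is a fin_num.
    exact: (integrable_fin_num measurableT (integ_abs _ hh)).
  rewrite -(fineK fi); congr EFin; apply/eqP; rewrite eq_le h0/=.
  by apply: Rintegral_ge0.
move/(ae_eq_integral_abs _ measurableT mh).
by apply: filterS => t /(_ Logic.I) [].
Qed.

Lemma integ_indic A h : measurable A -> integ h -> integ (fun t => \1_A t * h t).
Proof.
move=> mA hh; apply: (integ_le _ h) => // [|t].
  by apply: measurable_funM; [exact: measurable_indic|exact: integ_measurable].
rewrite normrM ler_piMl// indicE; by case: (t \in A); rewrite ?normr1 ?normr0.
Qed.

Lemma Rintegral_indic_cvg0 (A : nat -> set T) h : integ h ->
  (forall n, measurable (A n)) -> (forall n, A n.+1 `<=` A n) ->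
  \bigcap_n A n = set0 ->
  (fun n => Rintegral mu setT (fun t => `|\1_(A n) t * h t|)) @ \oo --> (0 : R).
Proof.
move=> hh mA decA capA.
have hA n : integ (fun t => `|\1_(A n) t * h t|) by apply/integ_abs/integ_indic.
have decA' n m : (n <= m)%N -> A m `<=` A n.
  move=> /subnK <-; elim: (m - n)%N => [|k IH] //=.
  by apply: subset_trans IH; exact: decA.
have : (\int[mu]_t (`|\1_(A n) t * h t|)%:E @[n --> \oo] --> \int[mu]_t (cst 0 t))%E.
  apply: (@dominated_cvg _ _ _ mu setT measurableT
    (fun n t => (`|\1_(A n) t * h t|)%:E) (cst 0%E) (fun t => (`|h t|)%:E)) => //.
  - by move=> n; exact: measurable_int (hA n).
  - move=> t _; have [k Akt] : exists k, ~ A k t.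
      apply: contrapT => h'; have : (\bigcap_n A n) t.
        by move=> n _; apply: contrapT => nA; apply: h'; exists n.
      by rewrite capA.
    apply: cvg_near_cst; exists k => // n /= kn.
    by rewrite indicE memNset ?mul0r ?normr0// => /(decA' _ _ kn).
  - exact: integ_abs.
  - move=> n t _ /=; rewrite lee_fin normr_id normrM ler_piMl// indicE.
    by case: (t \in A n); rewrite ?normr1 ?normr0.
rewrite integral0 => /fine_cvg; exact.
Qed.

End RealIntegral.

(** * The lattice structure of L_1(mu) carried over to the dual of [X] *)

Section L1Predual.
Context {R : realType} (X : normedModType R) {d} {T : measurableType d}.
Context (mu : {measure set T -> \bar R}) (Phi : (X -> R) -> T -> R).
Local Notation E := (dual (nspace_of X)).
Local Notation dom := (dual_dom (nspace_of X)).
Local Notation integ h := (mu.-integrable setT (EFin \o h)).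
Local Notation Int := (Rintegral mu setT).
Hypothesis hint : forall f, dom f -> integ (Phi f).
Hypothesis hlin : forall (a : R) f g, dom f -> dom g ->
  {ae mu, forall t, Phi (a *: f + g) t = a * Phi f t + Phi g t}.
Hypothesis hnorm : forall f, dom f ->
  ((dual_norm (nspace_of X) f)%:E = \int[mu]_t (`|Phi f t|)%:E)%E.
Hypothesis hsurj : forall h : T -> R, integ h ->
  exists f, dom f /\ {ae mu, forall t, Phi f t = h t}.
Let nsX := nspace_of_is_nspace X.
Let nsE := dual_is_nspace _ nsX.
Implicit Types (f g : ns_car E) (h : T -> R).

Let Phi_norm f : dom f -> ns_norm E f = Int (fun t => `|Phi f t|).
Proof. by move=> df; rewrite /Rintegral -hnorm. Qed.

Let PhiB f g : dom f -> dom g ->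
  {ae mu, forall t, Phi (f - g) t = Phi f t - Phi g t}.
Proof.
move=> df dg; have := hlin (-1) g f dg df; rewrite scaleN1r addrC.
by apply: filterS => t ->; rewrite mulN1r addrC.
Qed.

Let Phi0 : {ae mu, forall t, Phi 0 t = 0}.
Proof.
have d0 := dual_dom0 (nspace_of X).
by have := PhiB 0 0 d0 d0; rewrite subrr; apply: filterS => t ->; rewrite subrr.
Qed.

Let PhiD f g : dom f -> dom g ->
  {ae mu, forall t, Phi (f + g) t = Phi f t + Phi g t}.
Proof.
move=> df dg; have := hlin 1 f g df dg; rewrite scale1r.
by apply: filterS => t ->; rewrite mul1r.
Qed.

Let PhiZ a f : dom f -> {ae mu, forall t, Phi (a *: f) t = a * Phi f t}.
Proof.
move=> df; have := hlin a f 0 df (dual_dom0 _); rewrite addr0.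
by move: Phi0; apply: filterS2 => t -> ->; rewrite addr0.
Qed.

(** An isometry is injective. This turns almost everywhere identities into equalities of
    functionals, and the laws of [l1_M] are proved by it. *)
Let Phi_inj f g : dom f -> dom g -> {ae mu, forall t, Phi f t = Phi g t} -> f = g.
Proof.
move=> df dg fg; have dfg : dom (f - g) by exact: (ns_domB _ nsE).
apply/eqP; rewrite -subr_eq0; apply/eqP.
apply: (dual_norm_eq0 _ nsX _ dfg); have := Phi_norm _ dfg => /= ->.
rewrite (Rintegral_ae _ _ (cst 0)).
- by rewrite /Rintegral integral0.
- exact/integ_abs/hint.
- exact: integrable0.
- move: fg (PhiB _ _ df dg); apply: filterS2 => t e ->.
  by rewrite e subrr normr0.
Qed.

Let exPsi h : exists f, integ h -> dom f /\ {ae mu, forall t, Phi f t = h t}.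
Proof.
have [hh|] := pselect (integ h); last by exists 0.
by have [f hf] := hsurj _ hh; exists f.
Qed.

Let Psi h : ns_car E := projT1 (cid (exPsi h)).

Let Psi_dom h : integ h -> dom (Psi h).
Proof. by move=> hh; rewrite /Psi; case: cid => f /= /(_ hh) []. Qed.

Let PhiPsi h : integ h -> {ae mu, forall t, Phi (Psi h) t = h t}.
Proof. by move=> hh; rewrite /Psi; case: cid => f /= /(_ hh) []. Qed.

Definition l1_pos : set (ns_car E) :=
  [set f | dom f /\ {ae mu, forall t, 0 <= Phi f t}].

Definition l1_I : ns_car (dual E) :=
  fun f => if `[< dom f >] then Int (Phi f) else 0.

Definition l1_M (A : set T) f : ns_car E :=
  if `[< dom f >] then Psi (fun t => \1_A t * Phi f t) else 0.

Let l1_IE f : dom f -> l1_I f = Int (Phi f).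
Proof. by move=> df; rewrite /l1_I asboolT. Qed.

Let l1_I_le f : dom f -> `|l1_I f| <= ns_norm E f.
Proof.
move=> df; rewrite l1_IE// Phi_norm//; apply: le_normr_Rintegral => //.
exact: hint.
Qed.

Let l1_I_dom : dual_dom E l1_I.
Proof.
apply: (dual_domI _ _ 1) => [f df|a f g df dg|f df].
- by rewrite /l1_I asboolF.
- have dfg : dom (a *: f + g) by exact: (ns_domP _ nsE).
  rewrite !l1_IE// -Rintegral_lin; [|exact: hint..].
  apply: Rintegral_ae; [exact: hint| |exact: hlin].
  by apply: integ_lin; exact: hint.
- by rewrite mul1r; exact: l1_I_le.
Qed.

Let l1_posI f : l1_pos f -> ns_norm E f = l1_I f.
Proof.
move=> [df f0]; rewrite l1_IE// Phi_norm//; apply: Rintegral_ae.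
- exact/integ_abs/hint.
- exact: hint.
- by move: f0; apply: filterS => t f0; rewrite ger0_norm.
Qed.

(** The hypothesis says that the nonnegative function |Phi f| - Phi f has integral at most 0, so it
    vanishes almost everywhere. *)
Let l1_posP f : dom f -> ns_norm E f <= l1_I f -> l1_pos f.
Proof.
move=> df; rewrite l1_IE// Phi_norm// => le; split => //.
have hf := hint _ df; have haf := integ_abs _ _ hf.
pose h t := (-1) * Phi f t + `|Phi f t|.
have hh : integ h by exact: integ_lin.
have h0 t : 0 <= h t by rewrite /h mulN1r addrC subr_ge0 ler_norm.
have : {ae mu, forall t, h t = 0}.
  apply: Rintegral_abs_eq0 => //.
  rewrite (_ : (fun t => `|h t|) = h).
    by rewrite Rintegral_lin// mulN1r addrC subr_le0.
  by apply/funext => t; rewrite ger0_norm.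
apply: filterS => t; rewrite /h mulN1r addrC => /eqP.
by rewrite subr_eq0 => /eqP <-.
Qed.

Let l1_M_dom A f : measurable A -> dom f -> dom (l1_M A f).
Proof.
by move=> mA df; rewrite /l1_M asboolT//; apply/Psi_dom/integ_indic => //; exact: hint.
Qed.

Let PhiM A f : measurable A -> dom f ->
  {ae mu, forall t, Phi (l1_M A f) t = \1_A t * Phi f t}.
Proof.
by move=> mA df; rewrite /l1_M asboolT//; apply/PhiPsi/integ_indic => //; exact: hint.
Qed.

Let l1_posB f g : dom f -> dom g -> {ae mu, forall t, Phi f t <= Phi g t} ->
  l1_pos (g - f).
Proof.
move=> df dg fg; split; first exact: (ns_domB _ nsE).
by move: fg (PhiB _ _ dg df); apply: filterS2 => t fg ->; rewrite subr_ge0.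
Qed.

Let l1_pos_le f g : dom f -> dom g -> l1_pos (g - f) ->
  {ae mu, forall t, Phi f t <= Phi g t}.
Proof.
move=> df dg [_ fg]; move: fg (PhiB _ _ dg df); apply: filterS2 => t fg e.
by rewrite -subr_ge0 -e.
Qed.

Let Psi_pos h : integ h -> (forall t, 0 <= h t) -> l1_pos (Psi h).
Proof.
move=> hh h0; split; first exact: Psi_dom.
by move: (PhiPsi _ hh); apply: filterS => t ->.
Qed.

Let l1_maxr f : dom f -> integ (fun t => Num.max (Phi f t) 0).
Proof.
move=> df; apply: (integ_le _ _ (Phi f)); last exact: hint.
  apply: measurable_maxr => //; exact: (integ_measurable _ _ (hint _ df)).
by move=> t; case: (leP (Phi f t)) => // _; rewrite normr0.
Qed.

Let l1_minr f g : l1_pos f -> l1_pos g ->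
  exists k, [/\ dom k, {ae mu, forall t, Phi k t = Num.min (Phi f t) (Phi g t)} &
    l1_pos k].
Proof.
move=> [df f0] [dg g0].
have ii : integ (fun t => Num.min (Phi f t) (Phi g t)).
  apply: (integ_le _ _ (fun t => `|Phi f t| + `|Phi g t|)).
  - by apply: measurable_minr; [exact: (integ_measurable _ _ (hint _ df))
      |exact: (integ_measurable _ _ (hint _ dg))].
  - move=> t; rewrite [leRHS]ger0_norm; last by rewrite addr_ge0.
    by case: (leP (Phi f t)) => _; rewrite ?lerDl ?lerDr.
  - have := integ_lin mu 1 _ _ (integ_abs _ _ (hint _ df)) (integ_abs _ _ (hint _ dg)).
    by apply: eq_integrable => // t _ /=; rewrite mul1r.
exists (Psi (fun t => Num.min (Phi f t) (Phi g t))); split.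
- exact: Psi_dom.
- exact: PhiPsi.
- split; first exact: Psi_dom.
  move: f0 g0 (PhiPsi _ ii); apply: filterS3 => t f0 g0 ->.
  by rewrite le_min f0.
Qed.

Let l1_pos_dom f : l1_pos f -> dom f. Proof. by case. Qed.

Lemma l1_riesz : is_riesz E l1_pos.
Proof.
have norm_le h f : integ h -> dom f -> (forall t, `|h t| <= `|Phi f t|) ->
    ns_norm E (Psi h) <= ns_norm E f.
  move=> hh df hf; have dh := Psi_dom _ hh.
  rewrite !Phi_norm// (Rintegral_ae _ _ (fun t => `|h t|)).
  - by apply: le_Rintegral => //; apply/integ_abs => //; exact: hint.
  - exact/integ_abs/hint.
  - exact: integ_abs.
  - by move: (PhiPsi _ hh); apply: filterS => t ->.
split => //.
- split; first exact: dual_dom0.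
  by move: Phi0; apply: filterS => t ->.
- move=> f g [df f0] [dg g0]; split; first exact: (ns_domD _ nsE).
  move: f0 g0 (PhiD _ _ df dg); apply: filterS3 => t f0 g0 ->.
  by rewrite addr_ge0.
- move=> a f a0 [df f0]; split; first exact: (ns_domZ _ nsE).
  by move: f0 (PhiZ a _ df); apply: filterS2 => t f0 ->; rewrite mulr_ge0.
- exists 1 => // f df; have dnf : dom (- f) by exact: (ns_domN _ nsE).
  have PhiN : {ae mu, forall t, Phi (- f) t = - Phi f t}.
    by rewrite -scaleN1r; move: (PhiZ (-1) _ df); apply: filterS => t ->; rewrite mulN1r.
  have i1 := l1_maxr _ df; have i2 := l1_maxr _ dnf.
  exists (Psi (fun t => Num.max (Phi f t) 0)), (Psi (fun t => Num.max (Phi (- f) t) 0)).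
  split; rewrite ?mul1r.
  + by split; apply: Psi_pos => // t; rewrite le_max lexx orbT.
  + have d1 := Psi_dom _ i1; have d2 := Psi_dom _ i2.
    apply: Phi_inj => //; first exact: (ns_domB _ nsE).
    move: (PhiB _ _ d1 d2) (PhiPsi _ i1); apply: filter_app2.
    move: (PhiPsi _ i2) PhiN; apply: filterS2 => t e1 e2 -> ->.
    by rewrite e1 e2; case: (leP (Phi f t)); case: (leP (- Phi f t)); lra.
  + apply: norm_le => // t; case: (leP (Phi f t)) => // _; by rewrite normr0.
  + rewrite -(ns_normN _ nsE _ df); apply: norm_le => // t.
    by case: (leP (Phi (- f) t)) => // _; rewrite normr0.
- exists 1 => // f g pf pgf; have df := pf.1; have dgf := pgf.1.
  have dg : dom g by rewrite -[g](subrK f); exact: (ns_domD _ nsE).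
  have fg := l1_pos_le _ _ df dg pgf.
  have pg : l1_pos g.
    by split => //; move: pf.2 fg; apply: filterS2 => t; exact: le_trans.
  rewrite mul1r !l1_posI// -subr_ge0 -(dualB _ nsE _ l1_I_dom)// -l1_posI//.
  exact: (ns_norm_ge0 _ nsE).
- move=> x a b px pa pb pabx.
  have dx := px.1; have da := pa.1; have db := pb.1.
  have dab : dom (a + b) by exact: (ns_domD _ nsE).
  have xab := l1_pos_le _ _ dx dab pabx.
  (* The pointwise minimum of [x] and [a]: what it leaves of [x] is 0 or x - a, hence at most
     [b]. *)
  have [y [dy ey py]] := l1_minr _ _ px pa.
  have dxy : dom (x - y) by exact: (ns_domB _ nsE).
  exists y; split => //.
  + by apply: l1_posB => //; move: ey; apply: filterS => t ->; rewrite ge_min lexx.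
  + by apply: l1_posB => //; move: ey; apply: filterS => t ->; rewrite ge_min lexx orbT.
  + apply: l1_posB => //; move: xab ey; apply: filter_app2.
    move: (PhiD _ _ da db) (PhiB _ _ dx dy) pb.2; apply: filterS3 => t -> -> b0 h ->.
    by case: (leP (Phi x t)); lra.
Qed.

Let l1_M_pos A f : measurable A -> l1_pos f -> l1_pos (l1_M A f).
Proof.
move=> mA [df f0]; split; first exact: l1_M_dom.
by move: f0 (PhiM _ _ mA df); apply: filterS2 => t f0 ->; rewrite mulr_ge0.
Qed.

Let l1_MC A f : measurable A -> dom f -> f = l1_M A f + l1_M (~` A) f.
Proof.
move=> mA df; have mA' := measurableC mA.
have d1 := l1_M_dom _ _ mA df; have d2 := l1_M_dom _ _ mA' df.
apply: Phi_inj => //; first exact: (ns_domD _ nsE).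
move: (PhiM _ _ mA df) (PhiM _ _ mA' df) (PhiD _ _ d1 d2).
apply: filterS3 => t e1 e2 ->; rewrite e1 e2 !indicE in_setC.
by case: (t \in A); rewrite !(mul1r, mul0r, addr0, add0r).
Qed.

Let l1_M_norm A f : measurable A -> dom f ->
  ns_norm E f = ns_norm E (l1_M A f) + ns_norm E (l1_M (~` A) f).
Proof.
move=> mA df; have mA' := measurableC mA.
have nM B : measurable B ->
    ns_norm E (l1_M B f) = Int (fun t => `|\1_B t * Phi f t|).
  move=> mB; rewrite Phi_norm; last exact: l1_M_dom.
  apply: Rintegral_ae; [exact/integ_abs/hint/l1_M_dom
    |by apply/integ_abs/integ_indic => //; exact: hint|].
  by move: (PhiM _ _ mB df); apply: filterS => t ->.
rewrite !nM// Phi_norm// -RintegralD//;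
  try by apply/integ_abs/integ_indic => //; exact: hint.
congr Rintegral; apply/funext => t; rewrite !indicE in_setC.
by case: (t \in A); rewrite !(mul1r, mul0r, normr0, addr0, add0r).
Qed.

Let l1_M_cvg (A : nat -> set T) f : dom f ->
  (forall n, measurable (A n)) -> (forall n, A n.+1 `<=` A n) ->
  \bigcap_n A n = set0 -> (fun n => ns_norm E (l1_M (A n) f)) @ \oo --> (0 : R).
Proof.
move=> df mA decA capA.
rewrite (_ : (fun n => _) = fun n => Int (fun t => `|\1_(A n) t * Phi f t|)).
  by apply: Rintegral_indic_cvg0 => //; exact: hint.
apply/funext => n; rewrite Phi_norm; last exact: l1_M_dom.
apply: Rintegral_ae; [exact/integ_abs/hint/l1_M_dom
    |by apply/integ_abs/integ_indic => //; exact: hint|].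
by move: (PhiM _ _ (mA n) df); apply: filterS => t ->.
Qed.

Let l1_support e : l1_pos e -> exists B, [/\ measurable B, l1_M B e = e &
  forall f eps, l1_pos f -> l1_M B f = f -> 0 < eps -> exists A r,
    [/\ measurable A, 0 < r, l1_pos (r *: e - l1_M (~` A) f) &
        ns_norm E (l1_M A f) <= eps]].
Proof.
move=> [de e0]; pose B := ~` [set t | Phi e t <= 0].
have me := integ_measurable _ _ (hint _ de).
have mB : measurable B.
  by apply: measurableC; rewrite -[X in measurable X]setTI; exact: measurable_fun_le.
have BP t : (t \in B) = (0 < Phi e t).
  by rewrite in_setC ltNge; congr negb; apply/idP/idP; rewrite inE.
exists B; split => //.
  apply: Phi_inj => //; first exact: l1_M_dom.
  move: e0 (PhiM _ _ mB de); apply: filterS2 => t e0 ->.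
  by rewrite indicE BP; case: ltgtP e0 => // [_|<-] _; rewrite ?mul1r ?mulr0.
move=> f eps [df f0] Bf eps0.
have mf := integ_measurable _ _ (hint _ df).
(* The part of the support of [e] on which [f] exceeds (n + 1) e. It shrinks to the empty set as e >
   0 on [B]; starting from 1 keeps the multiple [r] positive. *)
pose A n := B `\` [set t | Phi f t <= n.+1%:R * Phi e t].
have mA n : measurable (A n).
  apply: measurableD => //; rewrite -[X in measurable X]setTI.
  by apply: measurable_fun_le => //; exact: measurable_funM.
have decA n : A n.+1 `<=` A n.
  move=> t [Bt h]; split => //; apply: contra_not h => /= h.
  apply: (le_trans h); rewrite ler_wpM2r ?ler_nat//.
  by apply: ltW; rewrite -BP inE.
have capA : \bigcap_n A n = set0.
  apply/seteqP; split => // t h; have [Bt _] := h 0%N Logic.I.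
  have et : 0 < Phi e t by rewrite -BP inE.
  have [_] := h (Num.truncn (Phi f t / Phi e t)) Logic.I; apply => /=.
  rewrite -ler_pdivrMr//; apply: ltW; exact: truncnS_gt.
have := l1_M_cvg A _ df mA decA capA.
move/cvgrPdist_le => /(_ _ eps0) [n _ /(_ n (leqnn n))].
rewrite sub0r normrN => nA; have mA' := measurableC (mA n).
exists (A n), n.+1%:R; split => //; last by apply: le_trans nA; exact: ler_norm.
have dre : dom (n.+1%:R *: e) by exact: (ns_domZ _ nsE).
apply: l1_posB => //; first exact: l1_M_dom.
have fB : {ae mu, forall t, Phi f t = \1_B t * Phi f t}.
  by have := PhiM _ _ mB df; rewrite Bf.
move: (PhiM _ _ mA' df) fB; apply: filter_app2.
move: (PhiZ n.+1%:R _ de) e0; apply: filterS2 => t er e0 eM fB.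
have re0 : 0 <= n.+1%:R * Phi e t by rewrite mulr_ge0.
rewrite er eM.
rewrite indicE in_setC; case: (boolP (t \in A n)) => /= tA; first by rewrite mul0r.
rewrite mul1r; have [tB|tB] := boolP (t \in B); last first.
  by rewrite fB indicE (negbTE tB) mul0r.
rewrite leNgt; apply/negP => lt; move/negP: tA; apply; rewrite inE; split.
  by rewrite inE in tB.
by apply/negP; rewrite -ltNge.
Qed.

(** On the cone the norm is [l1_I], so the norm of f m - f n, for n <= m, is the increment of a
    bounded monotone real sequence, and [f] is Cauchy. *)
Let l1_complete (f : nat -> ns_car E) (C : R) : (forall n, l1_pos (f n)) ->
  (forall n, l1_pos (f n.+1 - f n)) -> (forall n, ns_norm E (f n) <= C) ->
  exists g, ns_dom E g /\ forall eps, 0 < eps -> exists n0, forall n,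
    (n0 <= n)%N -> ns_norm E (g - f n) <= eps.
Proof.
move=> pf incf bf; have rE := l1_riesz.
have df n : dom (f n) by case: (pf n).
have inc n k : l1_pos (f (n + k)%N - f n).
  elim: k => [|k IH]; first by rewrite addn0 subrr; exact: (pos0 _ _ rE).
  rewrite addnS -(subrKA (f (n + k)%N)).
  exact: (posD _ _ rE _ _ (incf _) IH).
have nfB n m : (n <= m)%N -> ns_norm E (f m - f n) = l1_I (f m) - l1_I (f n).
  move=> /subnKC <-; rewrite l1_posI; last exact: inc.
  exact: (dualB _ nsE _ l1_I_dom _ _ (df _) (df _)).
pose u n := l1_I (f n).
have ub n : u n <= C by rewrite /u -(l1_posI _ (pf n)).
have hs : has_sup (range u) by split; [exists (u 0%N), 0%N|exists C => _ [n _ <-]].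
have cauchy eps : 0 < eps -> exists n0, forall n, (n0 <= n)%N ->
    dual_norm (nspace_of X) (f n - f n0) <= eps.
  move=> e0; have [_ [n0 _ <-] hn0] := sup_adherent e0 hs.
  exists n0 => n n0n; have := nfB _ _ n0n => /= ->.
  have : u n <= sup (range u) by apply: ub_le_sup; [exact: hs.2|exists n].
  by move: hn0; rewrite /u; lra.
by have [g dg hg] := dual_complete _ _ nsX df cauchy; exists g.
Qed.

Lemma l1_al_space : is_al_space E l1_pos l1_I l1_M.
Proof.
split => //.
- exact: l1_riesz.
- by move=> f df; apply: le_trans (l1_I_le _ df); exact: ler_norm.
- by move=> f pf; rewrite l1_posI.
- by move=> A f df; rewrite /l1_M asboolF.
- move=> A a f g mA df dg.
  have dl : dom (a *: f + g) by exact: (ns_domP _ nsE).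
  have d1 := l1_M_dom _ _ mA df; have d2 := l1_M_dom _ _ mA dg.
  apply: Phi_inj; [exact: l1_M_dom|exact: (ns_domP _ nsE)|].
  move: (PhiM _ _ mA df) (PhiM _ _ mA dg); apply: filter_app2.
  move: (PhiM _ _ mA dl) (hlin a _ _ df dg) (hlin a _ _ d1 d2).
  by apply: filterS3 => t -> -> -> -> ->; ring.
- move=> A B f mA mB df; have mAB : measurable (A `&` B) by exact: measurableI.
  have d1 := l1_M_dom _ _ mB df.
  apply: Phi_inj; [exact: l1_M_dom|exact: l1_M_dom|].
  move: (PhiM _ _ mB df) (PhiM _ _ mA d1) (PhiM _ _ mAB df).
  by apply: filterS3 => t e -> ->; rewrite e mulrA indicI.
- move=> f df; pose A := [set t | 0 <= Phi f t].
  have mA : measurable A.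
    rewrite -[A]setTI; apply: measurable_fun_le => //.
    exact: (integ_measurable _ _ (hint _ df)).
  have mA' := measurableC mA.
  exists A; split => //.
    split; first exact: l1_M_dom.
    move: (PhiM _ _ mA df); apply: filterS => t ->; rewrite indicE.
    by case: (boolP (t \in A)); rewrite ?mul0r// inE mul1r.
  have dM := l1_M_dom _ _ mA' df.
  split; first exact: (ns_domN _ nsE).
  rewrite -scaleN1r; move: (PhiM _ _ mA' df) (PhiZ (-1) _ dM).
  apply: filterS2 => t e ->; rewrite e indicE in_setC mulN1r oppr_ge0.
  case: (boolP (t \in A)) => /= tA; rewrite ?mul0r// mul1r.
  by rewrite leNgt; apply: contra tA => /ltW tA; rewrite inE.
Qed.

End L1Predual.

Theorem theorem3p12 (R : realType) (X : completeNormedModType R)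
  (Y : set X) :
  (L1_predual X \/ M_embedded X) ->
  finite_codim_closed_subspace X Y ->
  property_HB (nspace_of X) Y ->
  property_HB (dual (dual (nspace_of X)))
    (annihilator (dual (nspace_of X))
       (annihilator (nspace_of X) Y)).
Proof.
move=> [[d [T [mu [Phi [hint [hlin [hnorm hsurj]]]]]]]|MX].
  apply: property_HB_finite_codim.
  exact: al_L_complement (l1_al_space X mu Phi hint hlin hnorm hsurj).
apply: property_HB_finite_codim; apply: M_ideal_L_complement => //.
exact: nspace_of_is_nspace.
Qed.
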